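(* Let $(W,S)$ be a Coxeter system with $S$ finite, let $(\hat W,\hat S)$, $\theta$, the elements $z_I$ ($I\subseteq S$), $A=\hat T\smallsetminus W$, $l_A$, $\leq_A$, $R^A_{x,y}$, and the poset $V$ with $d$, the action of $\mathbf W=W\times W$ on $V$, and the Laurent polynomials $\tilde b_{w,v}$, be as defined in the context. Let $\Omega=\bigcup_{I\subseteq S}Wz_IW\subseteq\hat W$, regarded as a poset in the order induced by $\leq_A$. Then: (i) $\Omega$ is locally closed in $(\hat W,\leq_A)$, i.e. if $x\leq_A y\leq_A z$ with $x,z\in\Omega$ and $y\in\hat W$, then $y\in\Omega$. (ii) The map $\varphi\colon V\to\Omega$ given by $\varphi([I,a,b])=az_Ib^{-1}$ is a poset isomorphism. (iii) For $v\in V$, $l_A(\varphi(v))=d(v)-|S|$. (iv) $\varphi((a,b).v)=a\,\varphi(v)\,b^{-1}$ for any $v\in V$ and $(a,b)\in\mathbf W$. (v) For $v,w\in V$, $\tilde b_{w,v}=R^A_{\varphi(w),\varphi(v)}$.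
   Context: Coxeter notation. For a Coxeter system, $\ell$ is the length function and $\leq_\emptyset$ the Chevalley-Bruhat order. For $I\subseteq S$, $W_I$ is the standard parabolic subgroup generated by $I$, and $W^I=\{x\in W\mid x\leq_\emptyset xs\text{ for all }s\in I\}$ is the set of minimal left coset representatives of $W_I$ in $W$. Ring. $\mathcal R=\mathbb Z[u,u^{-1}]$, with ring involution $a\mapsto\bar a$, $\bar u=u^{-1}$; $\alpha=u-u^{-1}$, so $\bar\alpha=-\alpha$. ''Semi-linear'' means with respect to this involution. The poset $V$. $V=\{[I,a,b]\mid I\subseteq S,\ a\in W^I,\ b\in W\}$ (set of triples). Define $[I,a_1,b_1]\leq_1[J,a_2,b_2]$ if $I\subseteq J$, $a_2\leq_\emptyset a_1$, $b_1\leq_\emptyset b_2$; define $[I,a_1,b_1]\leq_2[J,a_2,b_2]$ if $I\subseteq J$ and $b_1=b_2c$ for some $c\in W_J$ with $\ell(b_1)=\ell(b_2)+\ell(c)$ and $a_2c\leq_\emptyset a_1$. The partial order $\leq$ on $V$ is the one generated by $\leq_1$ and $\leq_2$ ($v\leq w$ iff there is a finite chain from $v$ to $w$ each step of which is $\leq_1$ or $\leq_2$). The dimension function is $d([I,a,b])=-\ell(a)+\ell(b)+|I|$. Action on $V$. Let $\mathbf W=W\times W$, $\mathbf S=(S\times\{1\})\cup(\{1\}\times S)$. $\mathbf W$ acts on the left on $V$ by: $(1,s).[I,a,b]=[I,a,sb]$; $(s,1).[I,a,b]=[I,sa,b]$ if $sa\in W^I$; and $(s,1).[I,a,b]=[I,a,bt]$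 if $a\leq_\emptyset sa$ and $sa=at$ with $t\in I$ (for $s\in S$; exactly one of the last two cases occurs). The polynomials $\tilde b_{w,v}$. $\mathbf H$ is the Iwahori-Hecke algebra of $(\mathbf W,\mathbf S)$: free over $\mathcal R$ on $\tilde T_x$ ($x\in\mathbf W$) with, for $\mathbf s\in\mathbf S$, $\tilde T_{\mathbf s}\tilde T_x=\tilde T_{\mathbf sx}$ if $x\leq_\emptyset\mathbf sx$ and $\tilde T_{\mathbf s}\tilde T_x=\tilde T_{\mathbf sx}+\alpha\tilde T_x$ otherwise. $\mathcal M$ is the free $\mathcal R$-module on $\{\tilde m_v\mid v\in V\}$, an $\mathbf H$-module via $\tilde T_{\mathbf s}.\tilde m_v=\tilde m_{\mathbf s.v}$ if $d(v)<d(\mathbf s.v)$ and $\tilde T_{\mathbf s}.\tilde m_v=\tilde m_{\mathbf s.v}+\alpha\tilde m_v$ if $d(\mathbf s.v)<d(v)$. $\tilde{\mathcal M}$ is the completion of $\mathcal M$ consisting of formal (possibly infinite) $\mathcal R$-linear combinations of the $\tilde m_v$. For elements $a,b$ of a Coxeter group, $\tilde R_{a,b}(u)=(-u)^{-\ell(b)+\ell(a)}R_{a,b}(u^2)$ where $R_{a,b}$ are the Kazhdan-Lusztig $R$-polynomials ($R_{a,b}=0$ unless $a\leq_\emptyset b$). Springer's map $\Delta\colon\mathcal M\to\tilde{\mathcal M}$ is the semi-linear map $\Delta(\tilde m_v)=\sum_{w\in V}\tilde b_{w,v}\tilde m_w$ ($\tilde b_{w,v}\in\mathcal R$) uniquely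 determined by: (a) $\Delta(\tilde T_{\mathbf s}.m)=\tilde T_{\mathbf s}^{-1}.\Delta(m)$ for $\mathbf s\in\mathbf S$, $m\in\mathcal M$; (b) $\tilde b_{[I,a_1,b_1],[J,a_2,1]}=0$ if $I\not\subseteq J$ or $b_1\notin W_J$, and $=(\bar\alpha)^{|J|-|I|}\tilde R_{a_2b_1,a_1}$ otherwise. The group $\hat W$. $(\hat W,\hat S)$ is a fixed Coxeter system such that $S\subseteq\hat S$, $W=\hat W_S$ is the standard parabolic subgroup of $\hat W$ generated by $S$, and there is a bijection $\theta\colon S\to\hat S\smallsetminus S$ such that for $r,s\in S$, $r$ and $\theta(s)$ do not commute in $\hat W$ iff $r=s$ (no further restriction on orders of products). Fix an enumeration $S=\{r_1,\dots,r_n\}$ with distinct $r_i$. For $I\subseteq S$ put $z_I=\theta(r_{i_1})\cdots\theta(r_{i_m})\in\hat W$ where $S\smallsetminus I=\{r_{i_1},\dots,r_{i_m}\}$ with $i_1<\cdots<i_m$. Twisted order. $\hat T$ is the set of reflections of $(\hat W,\hat S)$, $A=\hat T\smallsetminus W$. For $x\in\hat W$, $N(x)=\{t\in\hat T\mid tx\leq_\emptyset x\}$ and $l_A(x)=\ell(x)-2|N(x^{-1})\cap A|$. The partial order $\leq_A$ on $\hat W$ is generated by the relations $x\leq_A tx$ for $x\in\hat W$, $t\in\hat T$ with $l_A(x)<l_A(tx)$. For $x\in\hat W$ let $\mathcal L_A(x)=\{s\in\hat S\mid sx\leq_A x\}$. The polynomials $R^A_{x,y}\in\mathbb Z[\bar\alpha]$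 are the unique family, indexed by $x\leq_A y$ and extended by $R^A_{x,y}=0$ when $x\not\leq_A y$, with $R^A_{1,1}=1$ and, for $x\leq_A y$ and $s\in\mathcal L_A(y)$, $R^A_{x,y}=R^A_{sx,sy}$ if $s\in\mathcal L_A(x)$ and $R^A_{x,y}=R^A_{sx,sy}+\bar\alpha R^A_{x,sy}$ if $s\notin\mathcal L_A(x)$. *)

(* Defs.v *)
From HB Require Import structures.
From mathcomp Require Import all_boot all_order all_algebra.
From mathcomp Require Import all_classical.
From mathcomp Require Import finmap fraction.
From Stdlib Require Import Relation_Operators.

Set Implicit Arguments.
Unset Strict Implicit.
Unset Printing Implicit Defensive.

Import Order.TTheory GRing.Theory Num.Theory.
Local Open Scope classical_set_scope.
Local Open Scope ring_scope.
Local Notation "x %:F" := (@tofrac _ x) : ring_scope.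

(* The ring Z[u, u^-1] is realised inside the fraction field of Z[X], with
   u = X, as the set of fractions p / X ^ n. *)
Local Notation fracZX := {fraction {poly int}}.

Definition laurent_pred : {pred fracZX} :=
  [pred x | `[< exists (p : {poly int}) (n : nat), x = p%:F / 'X%:F ^+ n >] ].

Lemma X_neq0 : ('X : {poly int})%:F != 0.
Proof. by rewrite tofrac_eq0 polyX_eq0. Qed.

Lemma laurent_predP x : reflect
  (exists (p : {poly int}) (n : nat), x = p%:F / 'X%:F ^+ n) (x \in laurent_pred).
Proof. exact: asboolP. Qed.

Lemma laurent_subring_closed : subring_closed laurent_pred.
Proof.
have Xn k : ('X : {poly int})%:F ^+ k != 0 by rewrite expf_neq0 ?X_neq0.
split.
- by apply/laurent_predP; exists 1, 0; rewrite expr0 divr1 rmorph1.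
- move=> _ _ /laurent_predP[p [k ->]] /laurent_predP[q [l ->]].
  apply/laurent_predP; exists (p * 'X ^+ l - q * 'X ^+ k), (k + l)%N.
  rewrite rmorphB !rmorphM !rmorphXn /= exprD -[- (_ / _)]mulNr.
  by rewrite addf_div // mulNr.
- move=> _ _ /laurent_predP[p [k ->]] /laurent_predP[q [l ->]].
  apply/laurent_predP; exists (p * q), (k + l)%N.
  by rewrite rmorphM exprD mulf_div.
Qed.

HB.instance Definition _ :=
  GRing.isSubringClosed.Build fracZX laurent_pred laurent_subring_closed.

Record laurent : predArgType :=
  Laurent { lval : fracZX; _ : lval \in laurent_pred }.
HB.instance Definition _ := [isSub for lval].
HB.instance Definition _ := [Choice of laurent by <:].
HB.instance Definition _ := [SubChoice_isSubComNzRing of laurent by <:].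

Definition lunit : {pred laurent} := [pred x | `[< exists y, y * x = 1 >] ].
Definition linv (x : laurent) : laurent := xget x [set y | y * x = 1].

Lemma lmulVx : {in lunit, left_inverse 1 linv *%R}.
Proof.
move=> x /asboolP[y yx].
by apply: (xgetPex x (P := [set y | y * x = 1])); exists y.
Qed.

Lemma lunitPl (x y : laurent) : y * x = 1 -> x \in lunit.
Proof. by move=> yx; apply/asboolP; exists y. Qed.

Lemma linv_out : {in [predC lunit], linv =1 id}.
Proof.
move=> x; rewrite inE => /asboolPn nx.
by rewrite /linv xgetPN // => y yx; apply: nx; exists y.
Qed.

HB.instance Definition _ :=
  GRing.ComNzRing_hasMulInverse.Build laurent lmulVx lunitPl linv_out.

Lemma Lu_subproof : 'X%:F \in laurent_pred.
Proof. by apply/laurent_predP; exists 'X, 0; rewrite expr0 divr1. Qed.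

Definition Lu : laurent := Laurent Lu_subproof.

Lemma LuV_subproof : 'X%:F^-1 \in laurent_pred.
Proof. by apply/laurent_predP; exists 1, 1; rewrite expr1 rmorph1 mul1r. Qed.

Lemma Lu_unit : Lu \is a GRing.unit.
Proof.
apply: (lunitPl (y := Laurent LuV_subproof)); apply: val_inj => /=.
by rewrite mulVf ?X_neq0.
Qed.

Definition intp_eval (x : laurent) : {poly int} -> laurent :=
  horner_eval x \o map_poly intr.
HB.instance Definition _ x := GRing.RMorphism.on (intp_eval x).

Lemma intp_evalX x : intp_eval x 'X = x.
Proof. by rewrite /intp_eval /= map_polyX /horner_eval hornerX. Qed.

Lemma intp_evalC x c : intp_eval x c%:P = c%:~R.
Proof. by rewrite /intp_eval /= map_polyC /horner_eval hornerC. Qed.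

Lemma val_intp_eval p : val (intp_eval Lu p) = p%:F.
Proof.
elim/poly_ind: p => [|p c IHp]; first by rewrite !rmorph0.
have cF : c%:P%:F = c%:~R.
  by rewrite -[in LHS](intz c) (rmorph_int polyC) (rmorph_int (@tofrac {poly int})).
rewrite rmorphD rmorphM /= intp_evalX intp_evalC rmorphD rmorphM /= IHp.
have -> : val (c%:~R : laurent) = c%:~R by exact: rmorph_int.
by rewrite -cF -rmorphM -rmorphD.
Qed.

Lemma laurent_repr (x : laurent) :
  exists pn : {poly int} * nat, x * Lu ^+ pn.2 = intp_eval Lu pn.1.
Proof.
case: x => x xL; have /laurent_predP[p [k xE]] := xL.
exists (p, k); apply: val_inj; rewrite val_intp_eval rmorphM rmorphXn /= xE.
by rewrite divfK ?expf_neq0 ?X_neq0.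
Qed.

(* p(u) / u ^ n is sent to p(u^-1) * u ^ n; this does not depend on p and n. *)
Definition bar (x : laurent) : laurent :=
  let: (p, n) := projT1 (cid (laurent_repr x)) in intp_eval Lu^-1 p * Lu ^+ n.

Lemma barE x p n : x * Lu ^+ n = intp_eval Lu p -> bar x = intp_eval Lu^-1 p * Lu ^+ n.
Proof.
rewrite /bar; case: (cid _) => -[q m] /= xq xp.
have /(congr1 (intp_eval Lu^-1)) : p * 'X ^+ m = q * 'X ^+ n.
  apply/eqP; rewrite -tofrac_eq -!val_intp_eval; apply/eqP; congr val.
  by rewrite !rmorphM !rmorphXn /= !intp_evalX -xq -xp mulrAC.
have um k : Lu ^+ k \is a GRing.unit by rewrite unitrX ?Lu_unit.
rewrite !rmorphM !rmorphXn /= !intp_evalX !exprVn => E.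
by rewrite -[intp_eval _ q](divrK (um n)) -E mulrAC -[_ / _ * _]mulrA mulVr ?mulr1.
Qed.

Lemma bar_is_zmod_morphism : zmod_morphism bar.
Proof.
move=> x y; have [[p m] /= xp] := laurent_repr x.
have [[q n] /= yq] := laurent_repr y.
have uU k : Lu ^- k * Lu ^+ k = 1 by rewrite mulVr // unitrX ?Lu_unit.
rewrite (barE xp) (barE yq) (@barE _ (p * 'X^n - q * 'X^m) (m + n)).
  rewrite rmorphB !rmorphM !rmorphXn /= !intp_evalX !exprVn exprD mulrBl.
  congr (_ - _); first by rewrite mulrACA uU mulr1.
  by rewrite mulrA -[_ / _ * _]mulrA uU mulr1.
rewrite rmorphB !rmorphM !rmorphXn /= !intp_evalX -xp -yq exprD mulrBl mulrA.
by rewrite [Lu ^+ m * _]mulrC mulrA.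
Qed.

Lemma bar_is_monoid_morphism : monoid_morphism bar.
Proof.
split=> [|x y]; first by rewrite (@barE _ 1 0) ?expr0 ?mulr1 rmorph1.
have [[p m] /= xp] := laurent_repr x; have [[q n] /= yq] := laurent_repr y.
rewrite (barE xp) (barE yq) (@barE _ (p * q) (m + n)) ?rmorphM ?exprD.
  by rewrite mulrACA.
by rewrite /= -xp -yq mulrACA.
Qed.

HB.instance Definition _ :=
  GRing.isZmodMorphism.Build laurent laurent bar bar_is_zmod_morphism.
HB.instance Definition _ :=
  GRing.isMonoidMorphism.Build laurent laurent bar bar_is_monoid_morphism.

Lemma bar_Lu : bar Lu = Lu^-1.
Proof. by rewrite (@barE _ 'X 0) ?expr0 ?mulr1 intp_evalX. Qed.

Definition alpha : laurent := Lu - Lu^-1.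

(* A Coxeter system (G, S) is given by an indexing of S by a finite type: S is
   the image of the injective family gen. *)
Definition cox_word (G : groupType) (I : finType) (gen : I -> G)
  (w : seq I) : G := (\prod_(i <- w) gen i)%g.

(* The congruence on words generated by (gen i * gen j) ^ k = 1, for all
   i, j, k for which this holds in G, i.e., k is a multiple of the order
   m(i, j) of gen i * gen j. *)
Inductive cox_equiv (G : groupType) (I : finType) (gen : I -> G) :
    seq I -> seq I -> Prop :=
| cox_equiv_refl w : cox_equiv gen w w
| cox_equiv_sym w w' : cox_equiv gen w w' -> cox_equiv gen w' w
| cox_equiv_trans w w' w'' :
    cox_equiv gen w w' -> cox_equiv gen w' w'' -> cox_equiv gen w w''
| cox_equiv_rel w w' i j k :
    ((gen i * gen j) ^+ k = 1)%g ->
    cox_equiv gen (w ++ flatten (nseq k [:: i; j]) ++ w') (w ++ w').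

Definition is_coxeter_system (G : groupType) (I : finType) (gen : I -> G) :
    Prop :=
  [/\ injective gen,
      forall i, gen i <> 1%g /\ (gen i * gen i = 1)%g,
      forall x, exists w, cox_word gen w = x &
      forall w w', cox_word gen w = cox_word gen w' -> cox_equiv gen w w'].

Definition has_word (G : groupType) (I : finType) (gen : I -> G) (x : G) :
  pred nat := fun k => [exists t : k.-tuple I, cox_word gen t == x].

(* The junk value 0 is only taken when x is not in the subgroup generated by
   gen. *)
Definition cox_len (G : groupType) (I : finType) (gen : I -> G) (x : G) : nat :=
  if pselect (exists k, has_word gen x k) is left ex then ex_minn ex else 0.

Definition parabolic (G : groupType) (I : finType) (gen : I -> G)
  (J : {set I}) : set G :=
  [set x | exists2 w : seq I, all (fun i => i \in J) w & cox_word gen w = x].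

Definition reflections (G : groupType) (I : finType) (gen : I -> G) : set G :=
  [set t | exists (g : G) (i : I), t = (g * gen i * g^-1)%g].

Definition refl_order (G : groupType) (I : finType) (gen : I -> G)
  (l : G -> int) : G -> G -> Prop :=
  clos_refl_trans G (fun x y =>
    exists2 t, reflections gen t & y = (t * x)%g /\ l x < l y).

(* The Chevalley-Bruhat order. *)
Definition bruhat (G : groupType) (I : finType) (gen : I -> G) :
  G -> G -> Prop := refl_order gen (fun x => (cox_len gen x)%:Z).

Definition inversions (G : groupType) (I : finType) (gen : I -> G) (x : G) :
  set G := [set t | reflections gen t /\ bruhat gen (t * x)%g x].

Definition twisted_len (G : groupType) (I : finType) (gen : I -> G)
  (A : set G) (x : G) : int :=
  (cox_len gen x)%:Z
    - 2 * (#|` fset_set (inversions gen x^-1%g `&` A)%classic |%fset)%:Z.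

Definition twisted_le (G : groupType) (I : finType) (gen : I -> G)
  (A : set G) : G -> G -> Prop := refl_order gen (twisted_len gen A).

(* The index i stands for the element gen i of S. *)
Definition twisted_descents (G : groupType) (I : finType) (gen : I -> G)
  (A : set G) (x : G) : set I :=
  [set i | twisted_le gen A (gen i * x)%g x].

Definition is_twisted_R (G : groupType) (I : finType) (gen : I -> G)
  (A : set G) (R : G -> G -> laurent) : Prop :=
  [/\ forall x y, ~ twisted_le gen A x y -> R x y = 0,
      forall x y, exists p : {poly int}, R x y = intp_eval (bar alpha) p,
      R 1%g 1%g = 1 &
      forall x y i, twisted_le gen A x y -> twisted_descents gen A y i ->
        (twisted_descents gen A x i ->
           R x y = R (gen i * x)%g (gen i * y)%g) /\
        (~ twisted_descents gen A x i ->
           R x y = R (gen i * x)%g (gen i * y)%g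
                   + bar alpha * R x (gen i * y)%g)].

(* The Kazhdan-Lusztig R-polynomials; the variable q is 'X. *)
Definition is_KL_R (G : groupType) (I : finType) (gen : I -> G)
  (R : G -> G -> {poly int}) : Prop :=
  [/\ forall x y, ~ bruhat gen x y -> R x y = 0,
      forall x, R x x = 1 &
      forall x y i, bruhat gen (gen i * y)%g y ->
        (bruhat gen (gen i * x)%g x ->
           R x y = R (gen i * x)%g (gen i * y)%g) /\
        (~ bruhat gen (gen i * x)%g x ->
           R x y = ('X - 1) * R x (gen i * y)%g
                   + 'X * R (gen i * x)%g (gen i * y)%g)].

Definition Rtilde (G : groupType) (I : finType) (gen : I -> G)
  (R : G -> G -> {poly int}) (x y : G) : laurent :=
  (- Lu) ^ (- (cox_len gen y)%:Z + (cox_len gen x)%:Z)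
    * intp_eval (Lu ^+ 2) (R x y).

Definition min_coset_reps (G : groupType) (I : finType) (gen : I -> G)
  (J : {set I}) : set G :=
  [set x | forall i, i \in J -> bruhat gen x (x * gen i)%g].

(* S = {r_0, ..., r_(n-1)} is enumerated by r : 'I_n -> W, and a subset of S is
   given by a set of indices. *)
Definition Vset (n : nat) (W : groupType) (r : 'I_n -> W) :
  set ({set 'I_n} * W * W) :=
  [set v | min_coset_reps r v.1.1 v.1.2].

Definition vI (n : nat) (W : groupType) (r : 'I_n -> W) (v : Vset r) :
  {set 'I_n} := (val v).1.1.
Definition va (n : nat) (W : groupType) (r : 'I_n -> W) (v : Vset r) : W :=
  (val v).1.2.
Definition vb (n : nat) (W : groupType) (r : 'I_n -> W) (v : Vset r) : W :=
  (val v).2.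

Definition V_le1 (n : nat) (W : groupType) (r : 'I_n -> W) (v w : Vset r) :
    Prop :=
  [/\ vI v \subset vI w, bruhat r (va w) (va v) & bruhat r (vb v) (vb w)].

Definition V_le2 (n : nat) (W : groupType) (r : 'I_n -> W) (v w : Vset r) :
    Prop :=
  vI v \subset vI w /\
  exists c, [/\ parabolic r (vI w) c, vb v = (vb w * c)%g,
               cox_len r (vb v) = (cox_len r (vb w) + cox_len r c)%N &
               bruhat r (va w * c)%g (va v)].

Definition V_le (n : nat) (W : groupType) (r : 'I_n -> W) :
    Vset r -> Vset r -> Prop :=
  clos_refl_trans (Vset r) (fun v w => V_le1 v w \/ V_le2 v w).

Definition V_dim (n : nat) (W : groupType) (r : 'I_n -> W) (v : Vset r) : int :=
  - (cox_len r (va v))%:Z + (cox_len r (vb v))%:Z + #|vI v|%:Z.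

Definition is_V_action (n : nat) (W : groupType) (r : 'I_n -> W)
    (act : W * W -> Vset r -> Vset r) : Prop :=
  [/\ forall v, act 1%g v = v,
      forall x y v, act (x * y)%g v = act x (act y v),
      forall i v, val (act (1%g, r i) v) = (vI v, va v, r i * vb v)%g,
      forall i v, min_coset_reps r (vI v) (r i * va v)%g ->
        val (act (r i, 1%g) v) = (vI v, r i * va v, vb v)%g &
      forall i j v, bruhat r (va v) (r i * va v)%g -> j \in vI v ->
        (r i * va v = va v * r j)%g ->
        val (act (r i, 1%g) v) = (vI v, va v, vb v * r j)%g].

(* The completed module is the module of all functions V -> Z[u, u^-1], and the
   free module on V is the submodule of the functions with finite support. *)
Definition fin_support (V : choiceType) (m : V -> laurent) : Prop :=
  finite_set [set v | m v != 0].

Definition m_basis (V : choiceType) (v : V) : V -> laurent :=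
  fun w => (w == v)%:R.

Definition bold_S (n : nat) (W : groupType) (r : 'I_n -> W) : set (W * W) :=
  [set s | exists i, s = (r i, 1%g) \/ s = (1%g, r i)].

Definition T_basis (n : nat) (W : groupType) (r : 'I_n -> W)
    (act : W * W -> Vset r -> Vset r) (s : W * W) (v : Vset r) :
    Vset r -> laurent :=
  fun w => m_basis (act s v) w
    + (if V_dim (act s v) < V_dim v then alpha * m_basis v w else 0).

(* For each w, at most two v contribute to the sum. *)
Definition T_act (n : nat) (W : groupType) (r : 'I_n -> W)
    (act : W * W -> Vset r -> Vset r) (s : W * W) (m : Vset r -> laurent) :
    Vset r -> laurent :=
  fun w => \sum_(v \in [set: Vset r]) m v * T_basis act s v w.

(* T_s ^ 2 = 1 + alpha T_s in the Iwahori-Hecke algebra, so the inverse of T_s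
   is T_s - alpha. *)
Definition T_inv_act (n : nat) (W : groupType) (r : 'I_n -> W)
    (act : W * W -> Vset r -> Vset r) (s : W * W) (m : Vset r -> laurent) :
    Vset r -> laurent :=
  fun w => T_act act s m w - alpha * m w.

(* btilde w v is the coefficient of m_w in Delta(m_v). *)
Definition is_springer_btilde (n : nat) (W : groupType) (r : 'I_n -> W)
    (act : W * W -> Vset r -> Vset r) (R : W -> W -> {poly int})
    (btilde : Vset r -> Vset r -> laurent) : Prop :=
  (exists Delta : (Vset r -> laurent) -> (Vset r -> laurent),
    [/\ forall c m m', fin_support m -> fin_support m' ->
          Delta (fun v => c * m v + m' v)
          = (fun w => bar c * Delta m w + Delta m' w),
        forall v, Delta (m_basis v) = btilde^~ v &
        forall s m, bold_S r s -> fin_support m ->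
          Delta (T_act act s m) = T_inv_act act s (Delta m)]) /\
  forall w v, vb v = 1%g ->
    (~ (vI w \subset vI v /\ parabolic r (vI v) (vb w)) -> btilde w v = 0) /\
    (vI w \subset vI v -> parabolic r (vI v) (vb w) ->
      btilde w v = bar alpha ^+ (#|vI v| - #|vI w|)
                   * Rtilde r R (va v * vb w)%g (va w)).

(* S is identified with its image under iota; theta i stands for
   theta(r_i). *)
Definition hat_gen (n : nat) (W What : groupType) (r : 'I_n -> W)
    (iota : W -> What) (theta : 'I_n -> What) : 'I_n + 'I_n -> What :=
  fun k => match k with inl i => iota (r i) | inr i => theta i end.

Definition is_hat_system (n : nat) (W What : groupType) (r : 'I_n -> W)
    (iota : W -> What) (theta : 'I_n -> What) : Prop :=
  [/\ is_coxeter_system r, injective iota,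
      is_coxeter_system (hat_gen r iota theta) &
      forall i j, ~ commute (iota (r i)) (theta j) <-> i = j].

Definition z_ (n : nat) (What : groupType) (theta : 'I_n -> What)
  (I : {set 'I_n}) : What := (\prod_(i < n | i \notin I) theta i)%g.

Definition hat_A (n : nat) (W What : groupType) (r : 'I_n -> W)
    (iota : W -> What) (theta : 'I_n -> What) : set What :=
  reflections (hat_gen r iota theta) `\` range iota.

Definition Omega (n : nat) (W What : groupType) (iota : W -> What)
    (theta : 'I_n -> What) : set What :=
  [set x | exists (I : {set 'I_n}) (a b : W),
     x = (iota a * z_ theta I * iota b)%g].

Definition phi (n : nat) (W What : groupType) (r : 'I_n -> W)
    (iota : W -> What) (theta : 'I_n -> What) (v : Vset r) : What :=
  (iota (va v) * z_ theta (vI v) * iota (vb v)^-1)%g.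

(* Main.v *)
(* Write x in hat W as x = d w with w in W and d minimal in dW. For A = hat T \ W
   one finds l_A(x) = l(w) - l(d), and an upward step x -> t x either raises w in
   the Bruhat order of W or replaces d by t d < d. For d = a z_I the second kind of
   step deletes a letter of a or of z_I, so Omega is an upper set for <=_A and the
   two kinds of steps translate into <=_1 and <=_2.

   The R^A satisfy a right-handed recursion for generators in W: the obstruction to
   it obeys the left-handed recursion, and induction on (l_A(y) - l_A(x), l(d))
   reduces its vanishing to W x W. This recursion is Springer's condition (a) for
   1 x S; the initial values (b) follow by descending along left descents of a_1
   down to products of the theta(r_i). *)

Require Import Defs.
From mathcomp Require Import all_boot all_order all_algebra.
From mathcomp Require Import all_classical.
From mathcomp Require Import finmap ring zify.
From Stdlib Require Import Relation_Operators Operators_Properties.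
Set Implicit Arguments.
Unset Strict Implicit.
Unset Printing Implicit Defensive.
Import Order.TTheory GRing.Theory Num.Theory.
Local Open Scope classical_set_scope.
Local Open Scope ring_scope.

(** * Words, inversions and lengths *)

(** Springer's recursion raises [b], so it multiplies [phi v] on the right, while [R^A] is given by
    left multiplications only; the right-handed recursion bridges the two. It serves a second time
    for the initial values: if [s a_2 = a_2 r_j] with [j] in [J], left multiplication by [s] creates
    a [b]-part, and the right-handed recursion moves [r_j] over to the other argument.

    The left recursion alone gives no induction on [y], because [l_A] need not be bounded below. The
    inductions therefore follow a left descent of the minimal part [d] of [x], which raises [x] in
    the twisted order. If it is a twisted descent of [y], the gap [l_A(y) - l_A(x)] falls in every
    term; if not, the recursion read backwards keeps the gap and shortens [d]. Once the gap is
    negative enough, everything vanishes.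

    Descents in both orders are read off [inv_parity], a parity count over words. Its cocycle
    identity yields the exchange property from the presentation and lets one lifting argument serve
    both orders. *)

Section Words.
Variables (G : groupType) (I : finType) (gen : I -> G).
Local Open Scope group_scope.

(** For a word [s_1 ... s_k] these are the reflections [s_1 ... s_{j-1} s_j s_{j-1} ... s_1]; left
    multiplication by the j-th one deletes the j-th letter. *)
Fixpoint prefix_refls (w : seq I) : seq G :=
  if w is i :: w' then gen i :: [seq gen i * t * (gen i)^-1 | t <- prefix_refls w']
  else [::].

Definition word_parity (w : seq I) (t : G) : bool :=
  odd (count_mem t (prefix_refls w)).

(* A cocycle (see [inv_parityM]) which, for a reflection [t], tells whether [t * x]
   is shorter than [x]. *)
Definition inv_parity (x t : G) : bool :=
  `[< exists w, cox_word gen w = x /\ word_parity w t >].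

Lemma cox_word_cons i w : cox_word gen (i :: w) = gen i * cox_word gen w.
Proof. by rewrite /cox_word big_cons. Qed.

Lemma cox_word_nil : cox_word gen [::] = 1.
Proof. by rewrite /cox_word big_nil. Qed.

Lemma cox_word_cat w1 w2 :
  cox_word gen (w1 ++ w2) = cox_word gen w1 * cox_word gen w2.
Proof. by rewrite /cox_word big_cat. Qed.

Lemma cox_word1 i : cox_word gen [:: i] = gen i.
Proof. by rewrite cox_word_cons cox_word_nil mulg1. Qed.

Lemma cox_word_rcons w i : cox_word gen (rcons w i) = cox_word gen w * gen i.
Proof. by rewrite -cats1 cox_word_cat cox_word1. Qed.

Lemma size_prefix_refls w : size (prefix_refls w) = size w.
Proof. by elim: w => //= i w IHw; rewrite size_map IHw. Qed.

Lemma prefix_refls_cat w1 w2 : prefix_refls (w1 ++ w2) =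
  prefix_refls w1 ++
  [seq cox_word gen w1 * t * (cox_word gen w1)^-1 | t <- prefix_refls w2].
Proof.
elim: w1 => [|i w1 IHw] /=.
  by rewrite (eq_map (g := id)) ?map_id // => t; rewrite cox_word_nil !gsimp.
rewrite {}IHw map_cat -map_comp; congr (_ :: _ ++ _); apply: eq_map => t /=.
by rewrite cox_word_cons !gnorm.
Qed.

Lemma count_conj (g t : G) (s : seq G) :
  count_mem t [seq g * u * g^-1 | u <- s] = count_mem (g^-1 * t * g) s.
Proof.
rewrite count_map; apply: eq_count => u /=.
by apply/eqP/eqP => [<-|->]; rewrite !gnorm.
Qed.

Lemma word_parity_cat w1 w2 t : word_parity (w1 ++ w2) t =
  word_parity w1 t
  (+) word_parity w2 ((cox_word gen w1)^-1 * t * cox_word gen w1).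
Proof. by rewrite /word_parity prefix_refls_cat count_cat oddD count_conj. Qed.

Lemma word_parity1 i t : word_parity [:: i] t = (gen i == t).
Proof. by rewrite /word_parity /= addn0; case: eqP. Qed.

Hypothesis cox : is_coxeter_system gen.

Lemma gen_neq1 i : gen i != 1.
Proof. by case: cox => _ /(_ i)[/eqP]. Qed.

Lemma gen_sqr i : gen i * gen i = 1.
Proof. by case: cox => _ /(_ i)[]. Qed.

Lemma genV i : (gen i)^-1 = gen i.
Proof. exact: mulg1_eq (gen_sqr i). Qed.

Lemma genK i x : gen i * (gen i * x) = x.
Proof. by rewrite mulgA gen_sqr mul1g. Qed.

Lemma mulgenK i x : x * gen i * gen i = x.
Proof. by rewrite -mulgA gen_sqr mulg1. Qed.

Lemma gen_inj : injective gen.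
Proof. by case: cox. Qed.

Lemma cox_wordP x : exists w, cox_word gen w = x.
Proof. by case: cox. Qed.

Lemma cox_word_rev w : cox_word gen (rev w) = (cox_word gen w)^-1.
Proof.
elim: w => [|i w IHw]; first by rewrite cox_word_nil invg1.
by rewrite rev_cons cox_word_rcons IHw cox_word_cons invgM genV.
Qed.

Lemma word_parity_mem w t : word_parity w t -> t \in prefix_refls w.
Proof.
rewrite /word_parity -has_pred1 has_count => odd_t; rewrite lt0n.
by apply: contraL odd_t => /eqP ->.
Qed.

Lemma prefix_reflsP w t : t \in prefix_refls w ->
  exists w1 i w2, [/\ w = w1 ++ i :: w2,
    t = cox_word gen w1 * gen i * (cox_word gen w1)^-1 &
    t * cox_word gen w = cox_word gen (w1 ++ w2)].
Proof.
move=> tw; have lt : (index t (prefix_refls w) < size w)%N.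
  by rewrite -size_prefix_refls index_mem.
set k := index t _ in lt; have wE := cat_take_drop k w.
case dE: (drop k w) => [|i w2].
  by move: lt; rewrite ltnNge -subn_eq0 -size_drop dE.
rewrite dE in wE; exists (take k w), i, w2.
suff tE : t = cox_word gen (take k w) * gen i * (cox_word gen (take k w))^-1.
  split=> //; rewrite tE.
  have -> : cox_word gen w = cox_word gen (take k w) * (gen i * cox_word gen w2).
    by rewrite -cox_word_cons -cox_word_cat wE.
  by rewrite cox_word_cat !gnorm mulgenK.
have sk : size (take k w) = k by rewrite size_take lt.
rewrite -[LHS](nth_index t tw) -/k -[in X in nth _ (_ X)]wE prefix_refls_cat.
by rewrite nth_cat size_prefix_refls sk ltnn subnn.
Qed.

Lemma prefix_refls_alternating i j k :
  prefix_refls (flatten (nseq k [:: i; j]))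
  = [seq (gen i * gen j) ^+ m * gen i | m <- iota 0 (k + k)].
Proof.
elim: k => [//|k IHk]; rewrite addSn addnS /= IHk !expg0 !mul1g.
congr [:: _, _ & _]; first by rewrite genV expg1.
rewrite -map_comp -map_comp -[in RHS](addn0 2%N) iotaDl -map_comp.
apply: eq_map => m /=.
by rewrite !genV expgS expgSr !mulgA.
Qed.

(** A relator of length [2k] inserts [2k] reflections; since [(gen i * gen j) ^+ k = 1], the last
    [k] repeat the first [k], so no parity changes. *)
Lemma cox_equiv_parity w w' : cox_equiv gen w w' ->
  cox_word gen w = cox_word gen w' /\ word_parity w =1 word_parity w'.
Proof.
elim=> {w w'} [w|w w' _ [e1 e2]|w w' w'' _ [e1 e2] _ [e3 e4]|w w' i j k ijk] //.
- by split=> [|t]; rewrite ?e2.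
- by split=> [|t]; rewrite ?e1 ?e2.
have c1 : cox_word gen (flatten (nseq k [:: i; j])) = 1.
  rewrite -ijk; elim: k {ijk} => [|k IHk]; first exact: cox_word_nil.
  by rewrite expgS /= !cox_word_cons IHk mulgA.
split=> [|t]; first by rewrite !cox_word_cat c1 mul1g.
rewrite !word_parity_cat c1 !gsimp; congr (_ (+) _).
rewrite -[RHS]addFb; congr (_ (+) _).
rewrite /word_parity prefix_refls_alternating iotaD map_cat count_cat add0n.
have -> : iota k k = [seq (k + m)%N | m <- iota 0 k] by rewrite -iotaDl addn0.
rewrite -map_comp.
rewrite (@eq_map _ _ _ (fun m => (gen i * gen j) ^+ m * gen i)) ?addnn ?odd_double //.
by move=> m /=; rewrite expgnDr ijk mul1g.
Qed.

(** The one place where the presentation of the group enters: words with the same value are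
    congruent, hence have the same parities. *)
Lemma inv_parityE w x t : cox_word gen w = x -> inv_parity x t = word_parity w t.
Proof.
move=> wx; apply/asboolP/idP => [[w' [w'x]]|]; last by exists w.
have [|_ ->//] := @cox_equiv_parity w' w.
by case: cox => _ _ _; apply; rewrite w'x.
Qed.

Lemma inv_parity1 t : inv_parity 1 t = false.
Proof. by rewrite (@inv_parityE [::]) ?cox_word_nil. Qed.

Lemma inv_parity_gen i t : inv_parity (gen i) t = (gen i == t).
Proof. by rewrite (@inv_parityE [:: i]) ?word_parity1 ?cox_word1. Qed.

Lemma inv_parityM x y t :
  inv_parity (x * y) t = inv_parity x t (+) inv_parity y (x^-1 * t * x).
Proof.
have [w wx] := cox_wordP x; have [w' wy] := cox_wordP y.
rewrite (inv_parityE _ wx) (inv_parityE _ wy).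
by rewrite (@inv_parityE (w ++ w')) ?cox_word_cat ?wx ?wy // word_parity_cat wx.
Qed.

Lemma inv_parityV x t : inv_parity x^-1 (x^-1 * t * x) = inv_parity x t.
Proof.
have := inv_parityM x x^-1 t; rewrite mulgV inv_parity1.
by case: inv_parity; case: inv_parity.
Qed.

Lemma reflectionsJ g t :
  reflections gen t -> reflections gen (g * t * g^-1).
Proof. by case=> h [i ->]; exists (g * h), i; rewrite !gnorm. Qed.

Lemma reflections_gen i : reflections gen (gen i).
Proof. by exists 1, i; rewrite !gsimp. Qed.

Lemma reflection_sqr t : reflections gen t -> t * t = 1.
Proof. by case=> g [i ->]; rewrite !gnorm mulgenK mulgV. Qed.

Lemma reflectionV t : reflections gen t -> t^-1 = t.
Proof. by move=> /reflection_sqr /mulg1_eq. Qed.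

(** In [t = g * gen i * g^-1] the contributions of [g] and [g^-1] cancel by [inv_parityV], which
    leaves that of [gen i]. *)
Lemma inv_parity_refl t : reflections gen t -> inv_parity t t.
Proof.
case=> g [i ->]; rewrite inv_parityM (_ : _^-1 * _ * _ = gen i); last first.
  by rewrite !gnorm.
rewrite inv_parityM inv_parity_gen -(inv_parityV g).
by rewrite (_ : g^-1 * _ * g = gen i) ?eqxx ?gnorm // addbAC addbb.
Qed.

Lemma inv_parityMrefl t x :
  reflections gen t -> inv_parity (t * x) t = ~~ inv_parity x t.
Proof.
move=> tR; rewrite inv_parityM inv_parity_refl // (reflectionV tR).
by rewrite reflection_sqr // mul1g.
Qed.

Lemma prefix_refls_refl w t : t \in prefix_refls w -> reflections gen t.
Proof. by case/prefix_reflsP=> w1 [i [w2 [_ -> _]]]; exists (cox_word gen w1), i. Qed.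

Local Notation len := (cox_len gen).

Lemma cox_len_word w : (len (cox_word gen w) <= size w)%N.
Proof.
rewrite /cox_len; case: pselect => // ex; case: ex_minnP => k _; apply.
by apply/existsP; exists (in_tuple w); rewrite eqxx.
Qed.

Lemma reduced_wordP x : exists2 w, cox_word gen w = x & size w = len x.
Proof.
rewrite /cox_len; case: pselect => [ex|[]].
  case: ex_minnP => k /existsP[w /eqP wx] _; exists w => //.
  by rewrite size_tuple.
have [w wx] := cox_wordP x; exists (size w); apply/existsP.
by exists (in_tuple w); rewrite wx.
Qed.

Lemma cox_len1 : len 1 = 0%N.
Proof. by apply/eqP; rewrite -leqn0 -cox_word_nil cox_len_word. Qed.

Lemma cox_len_eq0 x : (len x == 0%N) = (x == 1).
Proof.
apply/eqP/eqP => [x0|->]; last exact: cox_len1.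
have [w wx sw] := reduced_wordP x; rewrite x0 in sw.
by rewrite -wx (size0nil sw) cox_word_nil.
Qed.

Lemma cox_lenM x y : (len (x * y) <= len x + len y)%N.
Proof.
have [w <- <-] := reduced_wordP x; have [w' <- <-] := reduced_wordP y.
by rewrite -cox_word_cat -size_cat cox_len_word.
Qed.

Lemma cox_lenV x : len x^-1 = len x.
Proof.
suff le y : (len y^-1 <= len y)%N by apply/eqP; rewrite eqn_leq le -{1}[x]invgK le.
have [w <- <-] := reduced_wordP y.
by rewrite -cox_word_rev -size_rev cox_len_word.
Qed.

Lemma cox_len_gen i : len (gen i) = 1%N.
Proof.
apply/eqP; rewrite eqn_leq lt0n cox_len_eq0 gen_neq1 andbT -cox_word1.
exact: cox_len_word.
Qed.

(** An odd count makes [t] a prefix reflection of a reduced word, so [t] deletes a letter. If the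
    count is even, it is odd for [t * x], and the same argument shortens [t * x] to [x]. *)
Lemma cox_len_refl t x : reflections gen t -> (len (t * x) < len x)%N = inv_parity x t.
Proof.
have lt t' y : inv_parity y t' -> (len (t' * y) < len y)%N.
  have [w wy <-] := reduced_wordP y; rewrite (inv_parityE _ wy) => /word_parity_mem tw.
  case/prefix_reflsP: tw => w1 [i [w2 [wE _ e]]]; rewrite -wy e wE.
  by rewrite (leq_ltn_trans (cox_len_word _)) // !size_cat /= addnS.
move=> tR; apply/idP/idP => [|/lt//]; apply: contraTT => nx.
rewrite -leqNgt ltnW //; have := @lt t (t * x).
by rewrite inv_parityMrefl // mulgA reflection_sqr // mul1g; apply.
Qed.

Lemma cox_len_reflN t x : reflections gen t ->
  (len x < len (t * x))%N = ~~ inv_parity x t.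
Proof.
move=> tR; rewrite -inv_parityMrefl // -cox_len_refl //.
by rewrite mulgA reflection_sqr // mul1g.
Qed.

Lemma exchange w t : reflections gen t ->
  (len (t * cox_word gen w) < len (cox_word gen w))%N ->
  exists w1 i w2, w = w1 ++ i :: w2 /\ t * cox_word gen w = cox_word gen (w1 ++ w2).
Proof.
move=> tR; rewrite cox_len_refl // (inv_parityE _ erefl) => /word_parity_mem tw.
by case/prefix_reflsP: tw => w1 [i [w2 [-> _ ->]]]; exists w1, i, w2.
Qed.

Lemma cox_len_genl i x :
  len (gen i * x) = if inv_parity x (gen i) then (len x).-1 else (len x).+1.
Proof.
have le y : (len (gen i * y) <= (len y).+1)%N.
  by rewrite -add1n -(cox_len_gen i) cox_lenM.
case: ifPn => [|nx].
  rewrite -cox_len_refl; last exact: reflections_gen.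
  have := le (gen i * x); rewrite genK; case: (len x) => // k; rewrite !ltnS => h1 h2.
  by apply/eqP; rewrite eqn_leq h1 h2.
apply/eqP; rewrite eqn_leq le cox_len_reflN //; exact: reflections_gen.
Qed.

Lemma inv_parity_len_gt0 i x : inv_parity x (gen i) -> (0 < len x)%N.
Proof. by rewrite -cox_len_refl; [exact: leq_ltn_trans|exact: reflections_gen]. Qed.

Lemma cox_len_genr i x :
  len (x * gen i) = if inv_parity x^-1 (gen i) then (len x).-1 else (len x).+1.
Proof. by rewrite -cox_lenV invgM genV cox_len_genl cox_lenV. Qed.

(** If the leading [gen i] recurred later, it would be a prefix reflection of the tail, and [gen i]
    would delete a letter of the tail instead of lengthening it. *)
Lemma reduced_prefix_refls_uniq w :
  len (cox_word gen w) = size w -> uniq (prefix_refls w).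
Proof.
elim: w => //= i w IHw; rewrite cox_word_cons => red.
have redw : len (cox_word gen w) = size w.
  apply/eqP; rewrite eqn_leq cox_len_word -ltnS -red -add1n -(cox_len_gen i).
  exact: cox_lenM.
rewrite map_inj_uniq ?IHw ?andbT // => [|x y /divIg/mulgI//].
apply/mapP => -[t tw e].
have ti : t = gen i.
  by apply: (mulgI (gen i)); rewrite gen_sqr; apply: (mulIg (gen i)^-1);
    rewrite -e mul1g genV.
have [w1 [j [w2 [wE _ e2]]]] := prefix_reflsP tw.
have := cox_len_word (w1 ++ w2); rewrite -e2 ti red wE !size_cat /= addnS.
by rewrite ltnNge leqW // leqnSn.
Qed.

Lemma inv_parity_reduced w t : len (cox_word gen w) = size w ->
  inv_parity (cox_word gen w) t = (t \in prefix_refls w).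
Proof.
move=> red; rewrite (inv_parityE _ erefl) /word_parity.
by rewrite count_uniq_mem ?reduced_prefix_refls_uniq //; case: (_ \in _).
Qed.

(** The deletion property. It provides reduced words that use only the letters of a given word,
    hence reduced words inside a parabolic subgroup. *)
Lemma reduced_subword w :
  exists2 w', subseq w' w & cox_word gen w' = cox_word gen w /\ size w' = len
    (cox_word gen w).
Proof.
elim: w => [|i w [w' sw [wE sE]]]; first by exists [::]; rewrite ?cox_word_nil ?cox_len1.
rewrite cox_word_cons cox_len_genl; case: ifPn => [|_]; last first.
  by exists (i :: w'); rewrite /= ?eqxx ?cox_word_cons ?wE ?sE.
rewrite -cox_len_refl; last exact: reflections_gen.
rewrite -wE => /(exchange (reflections_gen i)) [w1 [j [w2 [w'E ->]]]].
exists (w1 ++ w2).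
  apply: subseq_trans (subseq_cons _ _); apply: subseq_trans sw.
  by rewrite w'E cat_subseq // subseq_cons.
by split=> //; rewrite wE -sE w'E !size_cat /= addnS.
Qed.

End Words.

(** * Lifting in reflection orders *)

Section ReflectionOrder.
Variables (G : groupType) (I : finType) (gen : I -> G).
Hypothesis cox : is_coxeter_system gen.
(* [desc] is [inv_parity] for the Chevalley-Bruhat order and [twisted_desc] for
   the twisted order. *)
Variables (l : G -> int) (desc : G -> G -> bool).
Hypothesis descP : forall t x, reflections gen t -> (l (t * x)%g < l x) = desc x t.
Hypothesis descN : forall t x, reflections gen t -> (l x < l (t * x)%g) = ~~ desc x t.
Hypothesis desc_gen : forall i t x, reflections gen t ->
  desc (gen i * x)%g (gen i * t * (gen i)^-1)%g = desc x t (+) (t == gen i).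
Local Open Scope group_scope.
Local Notation le := (refl_order gen l).

Lemma refl_order_refl x : le x x.
Proof. exact: rt_refl. Qed.

Lemma refl_order_trans y x z : le x y -> le y z -> le x z.
Proof. exact: rt_trans. Qed.

Lemma refl_order_step t x : reflections gen t -> (l x < l (t * x))%R -> le x (t * x).
Proof. by move=> tR lt; apply: rt_step; exists t. Qed.

Lemma refl_order_ind_l y (P : G -> Prop) : P y ->
  (forall x t, reflections gen t -> (l x < l (t * x))%R -> le (t * x) y ->
     P (t * x) -> P x) ->
  forall x, le x y -> P x.
Proof.
move=> Py step x xy; have {xy} := clos_rt_rt1n _ _ _ _ xy => xy.
elim: xy Py step => // {}x x' {}y [t tR [-> lt]] xy IH Py step.
by apply: (step _ t) => //; [exact: clos_rt1n_rt|exact: IH].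
Qed.

Lemma refl_order_ind_r x (P : G -> Prop) : P x ->
  (forall y t, reflections gen t -> (l y < l (t * y))%R -> le x y ->
     P y -> P (t * y)) ->
  forall y, le x y -> P y.
Proof.
move=> Px step y xy; have {xy} := clos_rt_rtn1 _ _ _ _ xy => xy.
elim: xy => // {}y y' [t tR [-> lt]] xy IH.
by apply: step => //; exact: clos_rtn1_rt.
Qed.

Lemma refl_order_le x y : le x y -> x = y \/ (l x < l y)%R.
Proof.
move: x; apply: refl_order_ind_l => [|x t _ lt _ [<-|lt']]; [by left|by right|].
by right; apply: lt_trans lt'.
Qed.

Lemma refl_order_len x y : le x y -> (l x <= l y)%R.
Proof. by case/refl_order_le => [->//|/ltW]. Qed.

Lemma refl_order_tr t x : reflections gen t -> le x (t * x) <-> (l x < l (t * x))%R.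
Proof.
move=> tR; split=> [|/(refl_order_step tR)//]; case/refl_order_le => // e.
case: tR => g [i tE]; have /eqP := gen_neq1 cox i; case.
apply: (mulgI g); rewrite mulg1; apply: (mulIg g^-1); rewrite -tE mulgV.
by apply: (mulIg x); rewrite -e mul1g.
Qed.

Lemma refl_order_tl t x : reflections gen t -> le (t * x) x <-> (l (t * x) < l x)%R.
Proof.
move=> tR; have := refl_order_tr (t * x) tR.
by rewrite mulgA (reflection_sqr cox) ?mul1g.
Qed.

(** By [desc_gen], left multiplication by [gen i] alters only the descent at [gen i] itself, so any
    other upward step can be conjugated. All lifting properties rest on this. *)
Lemma refl_step_gen i t x : reflections gen t -> (l x < l (t * x))%R -> t != gen i ->
  le (gen i * x) (gen i * (t * x)).
Proof.
move=> tR; rewrite descN // => nd neq.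
rewrite (_ : gen i * (t * x) = gen i * t * (gen i)^-1 * (gen i * x));
  last by rewrite !gnorm.
apply: refl_order_step; first exact: reflectionsJ.
by rewrite descN ?desc_gen // ?(negbTE neq) ?addbF //; exact: reflectionsJ.
Qed.

Lemma refl_order_lift_l i x y : le x y -> le (gen i * x) y \/ le (gen i * x) (gen i * y).
Proof.
move: x; apply: refl_order_ind_l => [|x t tR lt xy IH].
  by right; exact: refl_order_refl.
have [ti|ti] := eqVneq t (gen i); first by left; rewrite -ti.
have h := refl_step_gen tR lt ti.
by case: IH => h'; [left|right]; apply: refl_order_trans h'.
Qed.

Lemma refl_order_lift_r i x y : le x y -> le x (gen i * y) \/ le (gen i * x) (gen i * y).
Proof.
move: y; apply: refl_order_ind_r => [|y t tR lt xy IH].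
  by right; exact: refl_order_refl.
have [ti|ti] := eqVneq t (gen i).
  by left; rewrite ti (genK cox).
have h := refl_step_gen tR lt ti.
by case: IH => h'; [left|right]; apply: refl_order_trans h.
Qed.

Definition gdesc i x := desc x (gen i).

Lemma gdescN i x : gdesc i (gen i * x) = ~~ gdesc i x.
Proof.
have R := reflections_gen gen i.
by rewrite /gdesc -descN // -descP // (genK cox).
Qed.

Lemma refl_order_gen i x : le (gen i * x) x <-> gdesc i x.
Proof. by rewrite refl_order_tl ?descP //; exact: reflections_gen. Qed.

Lemma refl_order_genN i x : le x (gen i * x) <-> ~~ gdesc i x.
Proof. by rewrite refl_order_tr ?descN //; exact: reflections_gen. Qed.

Lemma lift_x_y i x y : ~~ gdesc i x -> le x y -> le x (gen i * y).
Proof.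
move=> /refl_order_genN xd /(refl_order_lift_r i)[//|h].
exact: refl_order_trans h.
Qed.

Lemma lift_down i x y : gdesc i x -> le x y -> le (gen i * x) (gen i * y).
Proof.
move=> xd /(refl_order_lift_l i)[|//]; apply: lift_x_y.
by rewrite gdescN xd.
Qed.

Lemma lift_up i x y : ~~ gdesc i y -> le x y -> le (gen i * x) (gen i * y).
Proof.
move=> /refl_order_genN yd /(refl_order_lift_l i)[h|//].
exact: refl_order_trans yd.
Qed.

End ReflectionOrder.

(** * The Bruhat order: lifting, inversion, subwords *)

Section Bruhat.
Variables (G : groupType) (I : finType) (gen : I -> G).
Hypothesis cox : is_coxeter_system gen.
Local Open Scope group_scope.
Local Notation len := (cox_len gen).
Local Notation le := (bruhat gen).

Definition left_desc i x := inv_parity gen x (gen i).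

Lemma bruhat_descP t x : reflections gen t ->
  ((len (t * x))%:Z < (len x)%:Z)%R = inv_parity gen x t.
Proof. exact: cox_len_refl. Qed.

Lemma bruhat_descN t x : reflections gen t ->
  ((len x)%:Z < (len (t * x))%:Z)%R = ~~ inv_parity gen x t.
Proof. exact: cox_len_reflN. Qed.

Lemma bruhat_desc_gen i t x : reflections gen t ->
  inv_parity gen (gen i * x) (gen i * t * (gen i)^-1)
  = inv_parity gen x t (+) (t == gen i).
Proof.
move=> _; rewrite (inv_parityM cox) (inv_parity_gen cox) !gnorm addbC; congr (_ (+) _).
apply/eqP/eqP => [e|->]; last by rewrite mulgK.
by apply: (mulgI (gen i)); apply: (mulIg (gen i)^-1); rewrite -e mulgK.
Qed.

Lemma bruhat_refl x : le x x. Proof. exact: refl_order_refl. Qed.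

Lemma bruhat_trans y x z : le x y -> le y z -> le x z.
Proof. exact: refl_order_trans. Qed.

Lemma bruhat_tl t x : reflections gen t -> le (t * x) x <-> inv_parity gen x t.
Proof. by move=> tR; rewrite -bruhat_descP //; exact: refl_order_tl. Qed.

Lemma bruhat_tr t x : reflections gen t -> le x (t * x) <-> ~~ inv_parity gen x t.
Proof. by move=> tR; rewrite -bruhat_descN //; exact: refl_order_tr. Qed.

Lemma bruhat_len x y : le x y -> x = y \/ (len x < len y)%N.
Proof. exact: refl_order_le. Qed.

Lemma bruhat_leq_len x y : le x y -> (len x <= len y)%N.
Proof. by case/bruhat_len => [->|/ltnW]. Qed.

Lemma bruhat_le1 x : le x 1 -> x = 1.
Proof. by case/bruhat_len => //; rewrite cox_len1. Qed.

Lemma left_descN i x : left_desc i (gen i * x) = ~~ left_desc i x.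
Proof. exact: (gdescN cox bruhat_descP bruhat_descN). Qed.

Lemma bruhat_gen i x : le (gen i * x) x <-> left_desc i x.
Proof. exact: bruhat_tl (reflections_gen gen i). Qed.

Lemma bruhat_genN i x : le x (gen i * x) <-> ~~ left_desc i x.
Proof. exact: bruhat_tr (reflections_gen gen i). Qed.

Lemma bruhat_lift_x_y i x y : ~~ left_desc i x -> le x y -> le x (gen i * y).
Proof. exact: (lift_x_y cox bruhat_descN bruhat_desc_gen). Qed.

Lemma bruhat_lift_down i x y : left_desc i x -> le x y -> le (gen i * x) (gen i * y).
Proof. exact: (lift_down cox bruhat_descP bruhat_descN bruhat_desc_gen). Qed.

Lemma bruhat_lift_up i x y : ~~ left_desc i y -> le x y -> le (gen i * x) (gen i * y).
Proof. exact: (lift_up cox bruhat_descN bruhat_desc_gen). Qed.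

(** On inverses, a step by [t] becomes a left step by the conjugate [x^-1 * t * x], and inversion
    preserves lengths. *)
Lemma bruhatV x y : le x y -> le x^-1 y^-1.
Proof.
move: x; apply: refl_order_ind_l => [|x t tR lt _]; first exact: bruhat_refl.
apply: bruhat_trans; rewrite invgM (reflectionV cox tR).
have tR' : reflections gen (x^-1 * t * x) by have := reflectionsJ x^-1 tR; rewrite invgK.
rewrite (_ : x^-1 * t = x^-1 * t * x * x^-1); last by rewrite mulgK.
apply: refl_order_step => //.
rewrite mulgK -(reflectionV cox tR) -invgM (cox_lenV cox) (cox_lenV cox).
exact: lt.
Qed.

(** Going down the chain, every step deletes one letter by [exchange]. *)
Lemma bruhat_subword x w : le x (cox_word gen w) ->
  exists2 w', subseq w' w & cox_word gen w' = x.
Proof.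
move: x; apply: refl_order_ind_l => [|x t tR lt _ [w' sw e]]; first by exists w.
have xE : x = t * cox_word gen w' by rewrite e mulgA (reflection_sqr cox) ?mul1g.
have := @exchange _ _ _ cox w' t tR.
rewrite -xE e; case=> [//|w1 [i [w2 [w'E ->]]]]; exists (w1 ++ w2) => //.
by apply: subseq_trans sw; rewrite w'E cat_subseq // subseq_cons.
Qed.

Lemma len_le1 x : len x = 0%N -> x = 1.
Proof. by move/eqP; rewrite cox_len_eq0 // => /eqP. Qed.

Lemma left_desc_ex x : x != 1 -> exists i, left_desc i x.
Proof.
have [w <- red] := reduced_wordP cox x; case: w red => [|i w] red.
  by rewrite cox_word_nil eqxx.
move=> _; exists i; rewrite /left_desc -(cox_len_refl cox); last exact: reflections_gen.
by rewrite -red /= cox_word_cons (genK cox) ltnS cox_len_word.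
Qed.

End Bruhat.

(** * Parabolic subgroups and minimal coset representatives *)

Section Parabolic.
Variables (G : groupType) (I : finType) (gen : I -> G).
Hypothesis cox : is_coxeter_system gen.
Variable K : {set I}.
Local Open Scope group_scope.
Local Notation len := (cox_len gen).
Local Notation le := (bruhat gen).
Local Notation eta := (inv_parity gen).
Local Notation WK := (parabolic gen K).

Lemma parabolic1 : WK 1.
Proof. by exists [::] => //; exact: cox_word_nil. Qed.

Lemma parabolicM x y : WK x -> WK y -> WK (x * y).
Proof.
by case=> w wK <- [w' wK' <-]; exists (w ++ w'); rewrite ?all_cat ?wK ?cox_word_cat.
Qed.

Lemma parabolicV x : WK x -> WK x^-1.
Proof. by case=> w wK <-; exists (rev w); rewrite ?all_rev ?cox_word_rev. Qed.

Lemma parabolicMl x y : WK x -> WK (x * y) <-> WK y.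
Proof.
move=> xK; split=> [|/(parabolicM xK)//].
by move/(parabolicM (parabolicV xK)); rewrite mulKg.
Qed.

Lemma parabolicMr x y : WK y -> WK (x * y) <-> WK x.
Proof.
move=> yK; split=> [|/parabolicM/(_ yK)//].
by move/parabolicM => /(_ _ (parabolicV yK)); rewrite mulgK.
Qed.

Lemma parabolicJ x y : WK x -> WK (x * y * x^-1) <-> WK y.
Proof.
by move=> xK; rewrite parabolicMr ?parabolicMl //; exact: parabolicV.
Qed.

Lemma parabolic_gen i : i \in K -> WK (gen i).
Proof. by move=> iK; exists [:: i]; rewrite ?cox_word1 //= iK. Qed.

Lemma parabolic_inv x t : WK x -> eta x t -> WK t.
Proof.
case=> w wK wx; rewrite (inv_parityE cox _ wx) => /word_parity_mem tw.
case/(prefix_reflsP cox): tw => w1 [i [w2 [wE -> _]]].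
move: wK; rewrite wE all_cat /= => /and3P[w1K iK _].
by apply/parabolicJ; [exists w1|exact: parabolic_gen].
Qed.

Lemma parabolic_reduced x : WK x ->
  exists w, [/\ all (fun i => i \in K) w, cox_word gen w = x & size w = len x].
Proof.
case=> w wK wx; have [w' sw [e se]] := reduced_subword cox w.
exists w'; split; rewrite ?e ?se ?wx //.
by apply/allP => i /(mem_subseq sw) /(allP wK).
Qed.

Lemma gen_parabolic i : WK (gen i) -> i \in K.
Proof.
move/parabolic_reduced=> [[|j [|k w]] []] //=; rewrite ?(cox_len_gen cox) //.
by move=> /andP[jK _]; rewrite cox_word1 => /(gen_inj cox) <-.
Qed.

Lemma bruhat_parabolic x y : le x y -> WK y -> WK x.
Proof.
move=> xy [w wK wy]; move: xy; rewrite -wy => /(bruhat_subword cox)[w' sw <-].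
by exists w' => //; apply/allP => i /(mem_subseq sw) /(allP wK).
Qed.

(** Quantified over all of [WK] and not only over its generators, so that the condition survives
    conjugation by [WK]; [min_rep_descP] gives the form with generators. *)
Definition is_min_rep (x : G) := forall t, WK t -> eta x^-1 t = false.

Lemma inv_parity_reflection x t : eta x t -> reflections gen t.
Proof.
have [w wx] := cox_wordP cox x; rewrite (inv_parityE cox _ wx).
by move/word_parity_mem; exact: prefix_refls_refl.
Qed.

Lemma inv_parity_min_rep x c t : is_min_rep x -> WK c -> WK t ->
  eta (x * c)^-1 t = eta c^-1 t.
Proof.
move=> xm cK tK; rewrite invgM (inv_parityM cox) invgK xm ?addbF //.
exact/parabolicJ.
Qed.

(** The letters of [c] are appended one by one: by [inv_parity_min_rep] the right descents in [K] of
    [x * c] and of [c] agree, so both lengths move together. *)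
Lemma min_rep_len x c : is_min_rep x -> WK c -> len (x * c) = (len x + len c)%N.
Proof.
move=> xm [w wK <-]; elim/last_ind: w wK => [|w i IHw].
  by rewrite cox_word_nil mulg1 cox_len1 addn0.
rewrite all_rcons => /andP[iK wK]; rewrite cox_word_rcons mulgA !(cox_len_genr cox).
have wP : WK (cox_word gen w) by exists w.
rewrite inv_parity_min_rep ?IHw //; last exact: parabolic_gen.
case: ifP => [wi|_]; last by rewrite addnS.
have := inv_parity_len_gt0 cox wi; rewrite (cox_lenV cox).
by case: (len (cox_word gen w)) => // k _; rewrite addnS.
Qed.

Lemma min_rep_exists x : exists x0 c, [/\ is_min_rep x0, WK c & x = x0 * c].
Proof.
have [k] := ubnP (len x); elim: k x => // k IHk x; rewrite ltnS => xk.
have [xm|] := pselect (is_min_rep x).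
  by exists x, 1; rewrite mulg1; split=> //; exact: parabolic1.
move/existsNP => [t /not_implyP[tK /eqP]]; rewrite eqbF_neg negbK => xt.
have tR := inv_parity_reflection xt.
have lt : (len (x * t) < len x)%N.
  by rewrite -(cox_lenV cox) invgM (reflectionV cox tR) -(cox_lenV cox x)
    (cox_len_refl cox).
have [x0 [c [x0m cK e]]] := IHk _ (leq_trans lt xk).
exists x0, (c * t); split=> //; first exact: parabolicM.
by rewrite mulgA -e -mulgA (reflection_sqr cox) ?mulg1.
Qed.

Lemma parabolic_desc c : WK c -> c != 1 -> exists2 i, i \in K & eta c^-1 (gen i).
Proof.
case/parabolic_reduced => w []; elim/last_ind: w => [|w i _].
  by rewrite cox_word_nil => _ <-; rewrite eqxx.
rewrite all_rcons cox_word_rcons size_rcons => /andP[iK _] <- red _; exists i => //.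
rewrite -(cox_len_refl cox); last exact: reflections_gen.
rewrite (cox_lenV cox) -red -(cox_lenV cox) invgM invgK (genV cox) (mulgenK cox).
by rewrite ltnS cox_len_word.
Qed.

(** Write [x = x0 * c] with [x0] minimal. If [c != 1], then [c] has a right descent in [K], and [x]
    inherits it. *)
Lemma min_rep_descP x : is_min_rep x <-> forall i, i \in K -> eta x^-1 (gen i) = false.
Proof.
split=> [xm i iK|xd]; first by apply: xm; exact: parabolic_gen.
have [x0 [c [x0m cK xE]]] := min_rep_exists x.
have [c1|/(parabolic_desc cK)[i iK ci]] := eqVneq c 1; first by rewrite xE c1 mulg1.
have := xd _ iK; rewrite xE inv_parity_min_rep ?ci //; exact: parabolic_gen.
Qed.

Lemma min_rep1 : is_min_rep 1.
Proof. by move=> t _; rewrite invg1 (inv_parity1 cox). Qed.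

Lemma min_rep_uniq x c x' c' : is_min_rep x -> is_min_rep x' -> WK c -> WK c' ->
  x * c = x' * c' -> x = x' /\ c = c'.
Proof.
move=> xm xm' cK cK' e.
have dK : WK (c' * c^-1) by apply: parabolicM => //; exact: parabolicV.
have xE : x = x' * (c' * c^-1) by rewrite mulgA -e mulgK.
(* Both [x] and [x'] are minimal, so each is longer than the other by the length of [c' * c^-1]. *)
have d1 : c' * c^-1 = 1.
  apply: (len_le1 cox); have := min_rep_len xm (parabolicV dK).
  have -> : x * (c' * c^-1)^-1 = x' by rewrite [X in X * _]xE mulgK.
  rewrite xE min_rep_len // (cox_lenV cox) => /eqP.
  by rewrite -addnA -{1}[len x']addn0 eqn_add2l eq_sym addn_eq0 => /andP[/eqP].
split; first by rewrite xE d1 mulg1.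
by rewrite -[LHS]mul1g -d1 mulgVK.
Qed.

(** A generator [gen j] can become an inversion of [(gen i * x)^-1] only if it equals
    [x^-1 * gen i * x]. *)
Lemma deodhar i x : is_min_rep x ->
  is_min_rep (gen i * x) \/ exists2 j, j \in K & gen i * x = x * gen j.
Proof.
move=> xm; have [|] := pselect (is_min_rep (gen i * x)); first by left.
move=> xN; right; apply: contrapT => nex; apply: xN; apply/min_rep_descP => j jK.
rewrite invgM (genV cox) (inv_parityM cox) (inv_parity_gen cox) invgK.
rewrite xm ?addFb //; last exact: parabolic_gen.
apply/eqP => e; apply: nex; exists j => //.
by rewrite e mulgVK.
Qed.

Lemma min_rep_desc i x : is_min_rep x -> left_desc gen i x -> is_min_rep (gen i * x).
Proof.
move=> xm xi; have [//|[j jK e]] := deodhar i xm.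
have := cox_len_genl cox i x; rewrite -/(left_desc gen i x) xi e.
rewrite min_rep_len //; last exact: parabolic_gen.
rewrite (cox_len_gen cox) addn1; have := inv_parity_len_gt0 cox xi.
by case: (len x) => // k _ /eqP; rewrite gtn_eqF.
Qed.

Lemma min_coset_repsE x : min_coset_reps gen K x <-> is_min_rep x.
Proof.
have e i : le x (x * gen i) <-> eta x^-1 (gen i) = false.
  split=> [/(bruhatV cox)|xi].
    rewrite invgM (genV cox) => /(bruhat_genN cox); exact: negbTE.
  rewrite -[x]invgK -[X in bruhat _ _ X]invgK; apply: (bruhatV cox).
  by rewrite invgM invgK (genV cox); apply/(bruhat_genN cox); rewrite /left_desc xi.
by rewrite min_rep_descP; split=> xK i /xK/e.
Qed.

Lemma parabolic_notin x j : WK x -> j \notin K -> eta x (gen j) = false.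
Proof.
move=> xK jK; apply: contraNF jK => /(parabolic_inv xK); exact: gen_parabolic.
Qed.

End Parabolic.

(** * The twisted order for the reflections outside a parabolic subgroup *)

Section Twisted.
Variables (G : groupType) (I : finType) (gen : I -> G).
Hypothesis cox : is_coxeter_system gen.
Variable K : {set I}.
Local Open Scope group_scope.
Local Notation len := (cox_len gen).
Local Notation eta := (inv_parity gen).
Local Notation WK := (parabolic gen K).
Local Notation A := (reflections gen `\` parabolic gen K)%classic.
Local Notation l := (twisted_len gen A).
Local Notation le := (twisted_le gen A).
Local Notation is_min := (is_min_rep gen K).

(** The inversions of [(d * w)^-1] are those of [w^-1], which lie in [WK], and the [w^-1 * u * w]
    for [u] an inversion of [d^-1], none of which lie in [WK] as [d] is minimal. So exactly [len d]
    of them are in [A]. *)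
Lemma twisted_lenE d w : is_min d -> WK w ->
  (l (d * w) = (len w)%:Z - (len d)%:Z)%R.
Proof.
move=> dm wK; have [v vE red] := reduced_wordP cox d^-1.
pose s := [seq w^-1 * u * w | u <- prefix_refls gen v].
have e : (inversions gen (d * w)^-1 `&` A)%classic = [set` [fset t in s]%fset].
  apply/seteqP; split=> t /=; rewrite inE /=.
    case=> [[tR tinv] [_ tK]]; move/(bruhat_tl cox (d * w)^-1 tR): tinv.
    rewrite invgM (inv_parityM cox) invgK.
    have -> : eta w^-1 t = false.
      by apply/negP => /(parabolic_inv cox (parabolicV cox wK)).
    rewrite addFb -vE (inv_parity_reduced cox) ?red ?vE // => tv.
    by apply/mapP; exists (w * t * w^-1) => //; rewrite !gnorm.
  case/mapP => u uv ->.
  have uR := prefix_refls_refl cox uv.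
  have tR : reflections gen (w^-1 * u * w) by have := reflectionsJ w^-1 uR; rewrite invgK.
  have du : eta d^-1 u by rewrite -vE (inv_parity_reduced cox) // red vE.
  have tK : ~ WK (w^-1 * u * w).
    have := parabolicJ cox u (parabolicV cox wK); rewrite invgK => -> uK.
    by rewrite dm in du.
  split=> //; split=> //; apply/(bruhat_tl cox) => //.
  rewrite invgM (inv_parityM cox) invgK.
  have -> : eta w^-1 (w^-1 * u * w) = false.
    by apply/negP => /(parabolic_inv cox (parabolicV cox wK)).
  by rewrite !gnorm.
rewrite /twisted_len e set_fsetK card_fseq undup_id; last first.
  rewrite map_inj_uniq => [|x y /mulIg/mulgI//].
  by apply: (reduced_prefix_refls_uniq cox); rewrite vE red.
rewrite size_map size_prefix_refls red (cox_lenV cox) (min_rep_len cox dm wK).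
by lia.
Qed.

(* [t] lies in the symmetric difference of [N(x)] and [x A x^-1]. *)
Definition twisted_desc x t := eta x t (+) ~~ `[< WK (x^-1 * t * x) >].

Lemma twisted_desc_refl t x : reflections gen t ->
  twisted_desc (t * x) t = ~~ twisted_desc x t.
Proof.
move=> tR; rewrite /twisted_desc (inv_parityMrefl cox) // addNb.
by congr (~~ (_ (+) ~~ asbool (WK _))); rewrite invgM !mulgA mulgVK.
Qed.

(** For [x = d * w], the case depends on whether [x^-1 * t * x] is in [WK]. If so, [t] acts on the
    factor [w] alone; if not, [t] is an inversion of [x], and this inversion comes from [d]. In the
    second case [t * d] need not be minimal. *)
Lemma twisted_step_cases d w t : is_min d -> WK w -> reflections gen t ->
  twisted_desc (d * w) t = false ->
  (exists2 w', WK w' & t * (d * w) = d * w' /\ bruhat gen w w' /\ (len w < len w')%N)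
  \/ (t * (d * w) = t * d * w /\ bruhat gen (t * d) d /\ (len (t * d) < len d)%N).
Proof.
move=> dm wK tR; rewrite /twisted_desc -(inv_parityV cox).
set t' := (d * w)^-1 * t * (d * w).
have tE : t * (d * w) = d * (w * t' * w^-1) * w by rewrite /t' !gnorm.
case: asboolP => [tK|tNK].
  rewrite addbF (inv_parity_min_rep cox dm wK tK) => wt; left.
  have tR' : reflections gen (w * t' * w^-1).
    rewrite (_ : _ * _ = d^-1 * t * d); last by rewrite /t' !gnorm.
    by have := reflectionsJ d^-1 tR; rewrite invgK.
  have up : ~~ eta w (w * t' * w^-1).
    by rewrite -(inv_parityV cox) -[w * t' * _]mulgA mulKg mulgVK wt.
  exists (w * t'); first exact: parabolicM.
  rewrite -[X in bruhat _ _ X](mulgVK w) -{3}[w * t'](mulgVK w) (cox_len_reflN cox) //.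
  split; first by rewrite tE !gnorm.
  by split=> //; apply/(bruhat_tr cox).
rewrite addbT => /negbFE.
have -> : eta (d * w)^-1 t' = eta d t.
  have -> : t' = (d * w)^-1 * t * (d * w) by [].
  rewrite (inv_parityV cox) (inv_parityM cox).
  suff -> : eta w (d^-1 * t * d) = false by rewrite addbF.
  apply/negP => /(parabolic_inv cox wK) tK; apply: tNK.
  by apply/(parabolicJ cox _ wK); rewrite /t' !gnorm.
move=> dt; right; split; first by rewrite mulgA.
by rewrite (cox_len_refl cox) //; split=> //; apply/(bruhat_tl cox).
Qed.

Lemma twisted_lt_ndesc t x : reflections gen t -> twisted_desc x t = false ->
  (l x < l (t * x)%g)%R.
Proof.
have [d [w [dm wK ->]]] := min_rep_exists cox K x => tR.
move/(twisted_step_cases dm wK tR) => [[w' w'K [-> [_ lt]]]|[-> [_ lt]]].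
  by rewrite !twisted_lenE // ltrD2r.
have [d' [c [d'm cK tdE]]] := min_rep_exists cox K (t * d).
have -> : t * d * w = d' * (c * w) by rewrite tdE mulgA.
rewrite !twisted_lenE //; last exact: parabolicM.
(* Passing from [w] to [c * w] loses at most [len c], whereas [len d] exceeds [len d' + len c]. *)
have := cox_lenM cox c^-1 (c * w); rewrite mulKg (cox_lenV cox).
by rewrite tdE (min_rep_len cox d'm cK) in lt; lia.
Qed.

Lemma twisted_descP t x : reflections gen t -> (l (t * x)%g < l x)%R = twisted_desc x t.
Proof.
move=> tR; case xt: (twisted_desc x t); last first.
  by apply/negbTE; rewrite -leNgt ltW // twisted_lt_ndesc.
have := @twisted_lt_ndesc t (t * x) tR.
by rewrite twisted_desc_refl // xt mulgA (reflection_sqr cox) // mul1g => ->.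
Qed.

Lemma twisted_descN t x : reflections gen t ->
  (l x < l (t * x)%g)%R = ~~ twisted_desc x t.
Proof.
by move=> tR; rewrite -twisted_desc_refl // -twisted_descP //
  mulgA (reflection_sqr cox) // mul1g.
Qed.

Lemma twisted_desc_gen i t x : reflections gen t ->
  twisted_desc (gen i * x) (gen i * t * (gen i)^-1) = twisted_desc x t (+) (t == gen i).
Proof.
move=> tR; rewrite /twisted_desc (bruhat_desc_gen cox) // addbAC.
congr (_ (+) ~~ asbool (WK _) (+) _).
by rewrite !gnorm.
Qed.

(** By [deodhar], a generator changes either [d] or [w], and that by one letter. *)
Lemma twisted_len_gen i x :
  l (gen i * x) = if twisted_desc x (gen i) then (l x - 1)%R else (l x + 1)%R.
Proof.
have iR := reflections_gen gen i.
have [d [w [dm wK xE]]] := min_rep_exists cox K x.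
have h : l (gen i * x) = (l x - 1)%R \/ l (gen i * x) = (l x + 1)%R.
  rewrite xE; have [idm|[j jK e]] := deodhar cox i dm.
    rewrite mulgA !twisted_lenE // (cox_len_genl cox).
    by case: ifP => [/(inv_parity_len_gt0 cox)|_]; lia.
  have jP := parabolic_gen gen jK.
  rewrite mulgA e -mulgA !twisted_lenE //; last exact: parabolicM.
  rewrite (cox_len_genl cox).
  by case: ifP => [/(inv_parity_len_gt0 cox)|_]; lia.
by have := twisted_descP x iR; case: (twisted_desc _ _); lia.
Qed.

Lemma twisted_desc_min_rep i d w : is_min d -> WK w -> left_desc gen i d ->
  twisted_desc (d * w) (gen i) = false.
Proof.
move=> dm wK di; have iR := reflections_gen gen i; apply/negbTE;
  rewrite -twisted_descN //.
rewrite mulgA !twisted_lenE //; last exact: min_rep_desc.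
rewrite (cox_len_genl cox) -/(left_desc gen i d) di.
by have := inv_parity_len_gt0 cox di; lia.
Qed.

(** Right multiplication by [gen j] is left multiplication by the reflection [x * gen j * x^-1]. *)
Definition twisted_rdesc x j := twisted_desc x (x * gen j * x^-1).

Lemma twisted_rdescP x j : (l (x * gen j)%g < l x)%R = twisted_rdesc x j.
Proof.
rewrite /twisted_rdesc -twisted_descP ?mulgVK //; apply: reflectionsJ;
  exact: reflections_gen.
Qed.

(** As [gen j] lies in [WK], conjugation by it does not affect membership in [WK]; only the
    inversion part can change, and only at the reflection [x * gen j * x^-1]. *)
Lemma twisted_desc_genr x i j : j \in K ->
  twisted_desc (x * gen j) (gen i) = twisted_desc x (gen i) (+) (gen i * x == x * gen j).
Proof.
move=> jK; rewrite /twisted_desc (inv_parityM cox) (inv_parity_gen cox) addbAC;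
  congr (_ (+) _ (+) _).
  congr (~~ _); apply: asbool_equiv_eq.
  rewrite invgM -!mulgA (parabolicMl cox _ (parabolicV cox (parabolic_gen gen jK))).
  by rewrite !mulgA (parabolicMr cox _ (parabolic_gen gen jK)).
apply/eqP/eqP => [->|e]; first by rewrite !mulgA mulgV mul1g.
by rewrite -mulgA e mulKg.
Qed.

Lemma twisted_rdesc_genl x i j :
  twisted_rdesc (gen i * x) j = twisted_rdesc x j (+) (gen i * x == x * gen j).
Proof.
have R : reflections gen (x * gen j * x^-1) by apply: reflectionsJ;
  exact: reflections_gen.
rewrite /twisted_rdesc.
have -> : gen i * x * gen j * (gen i * x)^-1
          = gen i * (x * gen j * x^-1) * (gen i)^-1.
  by rewrite !gnorm.
rewrite twisted_desc_gen //; congr (_ (+) _).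
by apply/eqP/eqP => [<-|<-]; rewrite ?mulgVK ?mulgK.
Qed.

Lemma twisted_rdesc_twisted_desc x i j : gen i * x = x * gen j ->
  twisted_rdesc x j = twisted_desc x (gen i).
Proof. by move=> e; rewrite /twisted_rdesc -e mulgK. Qed.

Lemma twisted_len_genr x j : j \in K ->
  l (x * gen j) = if twisted_rdesc x j then (l x - 1)%R else (l x + 1)%R.
Proof.
move=> jK; have [d [w [dm wK xE]]] := min_rep_exists cox K x.
have jP := parabolic_gen gen jK.
have h : l (x * gen j) = (l x - 1)%R \/ l (x * gen j) = (l x + 1)%R.
  rewrite xE -mulgA !twisted_lenE //; last exact: parabolicM.
  rewrite (cox_len_genr cox).
  case: ifP => [/(inv_parity_len_gt0 cox)|_]; rewrite ?(cox_lenV cox); lia.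
by have := twisted_rdescP x j; case: (twisted_rdesc _ _); lia.
Qed.

Lemma twisted_trans y x z : le x y -> le y z -> le x z.
Proof. exact: refl_order_trans. Qed.

Lemma twisted_refl x : le x x.
Proof. exact: refl_order_refl. Qed.

Lemma twisted_leq_len x y : le x y -> (l x <= l y)%R.
Proof. exact: refl_order_len. Qed.

Lemma twisted_gen i x : le (gen i * x) x <-> twisted_desc x (gen i).
Proof. exact: (refl_order_gen cox twisted_descP). Qed.

Lemma twisted_genN i x : le x (gen i * x) <-> ~~ twisted_desc x (gen i).
Proof. exact: (refl_order_genN cox twisted_descN). Qed.

Lemma twisted_lift_up i x y : ~~ twisted_desc y (gen i) -> le x y ->
  le (gen i * x) (gen i * y).
Proof. exact: (lift_up cox twisted_descN twisted_desc_gen). Qed.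

Lemma twisted_lift_down i x y : twisted_desc x (gen i) -> le x y ->
  le (gen i * x) (gen i * y).
Proof. exact: (lift_down cox twisted_descP twisted_descN twisted_desc_gen). Qed.

Lemma twisted_le_parabolic d w w' : is_min d -> WK w' -> bruhat gen w w' ->
  le (d * w) (d * w').
Proof.
move=> dm w'K; move: w; apply: refl_order_ind_l => [|w t tR lt tw IH].
  exact: twisted_refl.
apply: twisted_trans IH.
have twK : WK (t * w) by exact: (bruhat_parabolic cox tw).
have wK : WK w.
  apply: (bruhat_parabolic cox) twK; apply/(bruhat_tr cox) => //.
  by rewrite -(cox_len_reflN cox).
have -> : d * (t * w) = d * t * d^-1 * (d * w) by rewrite !gnorm.
apply: refl_order_step; first exact: reflectionsJ.
have -> : d * t * d^-1 * (d * w) = d * (t * w) by rewrite !gnorm.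
by rewrite !twisted_lenE // ltrD2r.
Qed.

(** A Bruhat chain from [e] to [d] may leave the minimal representatives, so its steps are not
    translated one by one. The induction strips left descents of [d], which keeps it minimal, and
    uses lifting in both orders. *)
Lemma twisted_le_min d e w : is_min d -> WK w -> bruhat gen e d -> le (d * w) (e * w).
Proof.
have [k] := ubnP (len d); elim: k d e => // k IHk d e; rewrite ltnS => dk dm wK ed.
have [d1|/(left_desc_ex cox)[i di]] := eqVneq d 1.
  by move: ed; rewrite d1 => /(bruhat_le1) ->; exact: twisted_refl.
have lt : (len (gen i * d) < k)%N.
  by rewrite (leq_trans _ dk) // (cox_len_refl cox) //; exact: reflections_gen.
have up : ~~ twisted_desc (d * w) (gen i) by rewrite twisted_desc_min_rep.
have IH e' : bruhat gen e' (gen i * d) -> le (gen i * (d * w)) (e' * w).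
  by move=> h; rewrite mulgA; apply: IHk => //; exact: (min_rep_desc cox).
have [ei|ei] := boolP (left_desc gen i e); last first.
  apply: twisted_trans (IH e _); first by apply/twisted_genN.
  exact: (bruhat_lift_x_y cox).
have := IH (gen i * e) (bruhat_lift_down cox ei ed); rewrite -mulgA => h.
have [ewi|ewi] := boolP (twisted_desc (e * w) (gen i)); last first.
  have := twisted_lift_down (i := i) _ h; rewrite !(genK cox); apply.
  by rewrite twisted_desc_refl //; exact: reflections_gen.
apply: twisted_trans (_ : le (gen i * (e * w)) _); last by apply/twisted_gen.
apply: twisted_trans h; exact/twisted_genN.
Qed.

(** By [twisted_step_cases], an upward step multiplies within [WK] or replaces [d] by a
    Bruhat-smaller element; neither leaves the larger parabolic subgroup. *)
Lemma twisted_le_parabolic_up (K' : {set I}) x y : K \subset K' ->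
  le x y -> parabolic gen K' x -> parabolic gen K' y.
Proof.
move=> /fintype.subsetP KK xy xK; move: y xy; apply: refl_order_ind_r => // y t tR lt _.
have sub z : WK z -> parabolic gen K' z.
  by case=> w wK <-; exists w => //; apply: sub_all wK => k /KK.
have [d [w [dm wK yE]]] := min_rep_exists cox K y; rewrite yE in lt * => yK.
have dK : parabolic gen K' d by apply/(parabolicMr cox d (sub _ wK)).
have [|[w' w'K [-> _]]|[-> [/(bruhat_parabolic cox)/(_ dK) tdK _]]] :=
  twisted_step_cases dm wK tR; first by apply/negbTE; rewrite -twisted_descN.
- by apply: parabolicM => //; exact: sub.
- by apply: parabolicM => //; exact: sub.
Qed.

Lemma twisted_le_WK x y : le x y -> WK x -> WK y.
Proof. exact: twisted_le_parabolic_up. Qed.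

End Twisted.

(** * Left and right recursions for the twisted R-polynomials *)

Section TwistedR.
Variables (G : groupType) (I : finType) (gen : I -> G).
Hypothesis cox : is_coxeter_system gen.
Variable K : {set I}.
Local Notation len := (cox_len gen).
Local Notation WK := (parabolic gen K).
Local Notation A := (reflections gen `\` parabolic gen K)%classic.
Local Notation l := (twisted_len gen A).
Local Notation le := (twisted_le gen A).
Local Notation is_min := (is_min_rep gen K).
Local Notation td := (twisted_desc gen K).
Local Notation rd := (twisted_rdesc gen K).
Variable R : G -> G -> laurent.
Hypothesis RP : is_twisted_R gen A R.
Local Notation ab := (bar alpha).

Lemma twisted_R0 x y : ~ le x y -> R x y = 0.
Proof. by case: RP => + _ _ _; apply. Qed.

Lemma twisted_desc_genK i x : td (gen i * x)%g (gen i) = ~~ td x (gen i).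
Proof. exact: (twisted_desc_refl cox K x (reflections_gen gen i)). Qed.

(** The defining recursion freed from [le x y]: if [x] is not below [y], lifting shows that the
    terms on the right vanish too. *)
Lemma twisted_R_rec i x y : td y (gen i) ->
  R x y = R (gen i * x)%g (gen i * y)%g
          + (if td x (gen i) then 0 else ab * R x (gen i * y)%g).
Proof.
move=> yd; have desc z : twisted_descents gen A z i <-> td z (gen i).
  exact: (twisted_gen cox).
have [xy|xNy] := pselect (le x y).
  case: RP => _ _ _ /(_ x y i xy); case; first exact/desc.
  move=> h1 h2; case: ifP => [/desc/h1 ->|/negbT xd]; first by rewrite addr0.
  by apply: h2 => /desc; apply/negP.
have sy : le (gen i * y)%g y by apply/(twisted_gen cox).
have e1 : R (gen i * x)%g (gen i * y)%g = 0.
  apply: twisted_R0 => h; apply: xNy.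
  rewrite -(genK cox i x) -(genK cox i y); apply: (twisted_lift_up cox) h.
  by rewrite twisted_desc_genK yd.
rewrite (twisted_R0 xNy) e1; case: ifP => _; rewrite ?addr0 //.
rewrite (@twisted_R0 x) ?mulr0 ?addr0 // => h; apply: xNy; exact: twisted_trans h sy.
Qed.

Lemma twisted_R1 x : R x x = 1.
Proof.
have [w <-] := cox_wordP cox x; elim: w => [|i w IHw].
  by rewrite cox_word_nil; case: RP.
rewrite cox_word_cons -IHw; set y := cox_word gen w.
case yi: (td y (gen i)); first by rewrite [RHS](@twisted_R_rec i) ?yi ?addr0.
by rewrite (@twisted_R_rec i) ?twisted_desc_genK ?yi // addr0 !(genK cox).
Qed.

Variable j : I.
Hypothesis jK : j \in K.

(* The coefficient of [m_x] in [Delta (m_y T_j) - Delta (m_y) T_j^-1]. *)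
Definition right_defect x y :=
  R x (y * gen j)%g + (if rd y j then ab * R x y else 0)
  - R (x * gen j)%g y - (if rd x j then 0 else ab * R x y).
Local Notation D := right_defect.

(** Left multiplication by [gen i] and right multiplication by [gen j] leave each other's descents
    alone, except at a [z] with [gen i * z = z * gen j], where the two descents coincide. Splitting
    on this for [x] and for [y] reduces the claim to ring identities. *)
Lemma right_defect_rec i x y : td y (gen i) ->
  D x y = D (gen i * x)%g (gen i * y)%g
          + (if td x (gen i) then 0 else ab * D x (gen i * y)%g).
Proof.
move=> yd; rewrite /right_defect.
have RA_rec x' y' := @twisted_R_rec i x' y'.
have xc := twisted_desc_genr cox x i jK; have xc' := twisted_rdesc_genl cox K x i j.
have yc := twisted_desc_genr cox y i jK; have yc' := twisted_rdesc_genl cox K y i j.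
have xe : (gen i * x == x * gen j)%g -> rd x j = td x (gen i).
  by move/eqP; exact: twisted_rdesc_twisted_desc.
have ye : (gen i * y == y * gen j)%g -> rd y j = td y (gen i).
  by move/eqP; exact: twisted_rdesc_twisted_desc.
have xt := twisted_desc_genK i x.
have as_ z : (gen i * (z * gen j) = gen i * z * gen j)%g by rewrite mulgA.
have [ey|ey] := eqVneq (gen i * y)%g (y * gen j)%g.
  rewrite -ey (_ : (gen i * y * gen j)%g = y); last by rewrite ey (mulgenK cox).
  rewrite yc' ey eqxx ye ?ey // yd /= -ey.
  rewrite (RA_rec x y) // (RA_rec (x * gen j)%g y) // (RA_rec (gen i * x)%g y) //.
  rewrite xt xc xc' !as_ (genK cox).
  have [ex|ex] := eqVneq (gen i * x)%g (x * gen j)%g.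
    rewrite xe ?ex // (mulgenK cox) -ex.
    by case: (td x (gen i)) => /=; ring.
  by case: (td x (gen i)); case: (rd x j) => /=; ring.
rewrite yc' (negbTE ey) addbF.
rewrite (RA_rec x (y * gen j)%g) ?yc
  ?(negbTE ey) ?addbF // (RA_rec x y) // (RA_rec (x * gen j)%g y) //.
rewrite xc xc' !as_.
have [ex|ex] := eqVneq (gen i * x)%g (x * gen j)%g.
  rewrite xe ?ex // (mulgenK cox) -ex.
  by case: (td x (gen i)); case: (rd y j) => /=; ring.
by case: (td x (gen i)); case: (rd x j); case: (rd y j) => /=; ring.
Qed.

Lemma right_defect_le x y : D x y <> 0 ->
  [\/ le x (y * gen j)%g, le x y | le (x * gen j)%g y].
Proof.
move=> h; apply: contrapT => n; apply: h; rewrite /right_defect.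
rewrite (@twisted_R0 x (y * gen j)%g) ?(@twisted_R0 x y)
  ?(@twisted_R0 (x * gen j)%g y) ?mulr0.
  by rewrite !if_same !subr0 addr0.
all: by move=> ?; apply: n; first [by constructor 1|by constructor 2|by constructor 3].
Qed.

Lemma right_defect_len x y : D x y <> 0 -> l x <= l y + 1.
Proof.
case/right_defect_le => /(twisted_leq_len (K := K)); rewrite ?(twisted_len_genr cox _ jK).
- by case: ifP => _; lia.
- by lia.
- by case: ifP => _; lia.
Qed.

Lemma right_defect_WK x y : D x y <> 0 -> WK x -> WK y.
Proof.
have jP := parabolic_gen gen jK.
move=> /right_defect_le h xK; case: h => [h|h|h].
- by apply/(parabolicMr cox y jP); exact: (twisted_le_WK cox h).
- exact: (twisted_le_WK cox h).
- by apply: (twisted_le_WK cox h); exact: parabolicM.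
Qed.

Lemma twisted_desc_WK x i : WK x -> i \in K -> td x (gen i) = left_desc gen i x.
Proof.
move=> xK iK; rewrite /twisted_desc; case: asboolP; first by rewrite addbF.
case; apply: parabolicM => //; apply: parabolicM; last exact: parabolic_gen.
exact: parabolicV.
Qed.

Lemma twisted_len_WK x : WK x -> l x = (len x)%:Z.
Proof.
move=> xK; rewrite -[x]mul1g (twisted_lenE cox (@min_rep1 _ _ _ cox K)) //.
by rewrite cox_len1 subr0 mul1g.
Qed.

Lemma twisted_R_WK1 x : WK x -> R x 1%g = (x == 1%g)%:R.
Proof.
move=> xK; have [->|x1] := eqVneq x 1%g; first exact: twisted_R1.
apply: twisted_R0 => /(twisted_leq_len (K := K)).
rewrite twisted_len_WK // -[1%g]mulg1 twisted_len_WK mulg1 ?cox_len1;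
  last exact: parabolic1.
by rewrite lez_nat leqn0 (cox_len_eq0 cox) (negbTE x1).
Qed.

(** On [WK] the twisted descents are the ordinary ones, so the left recursion can be run down to
    [y = 1], where only [x = 1] and [x = gen j] give nonzero terms. *)
Lemma right_defect_parabolic x y : WK x -> WK y -> D x y = 0.
Proof.
have [k] := ubnP (len y); elim: k x y => // k IHk x y; rewrite ltnS => yk xK yK.
have jP := parabolic_gen gen jK.
have [y1|y1] := eqVneq y 1%g; last first.
  have [|i iK] := parabolic_desc cox (parabolicV cox yK); first by rewrite invg_eq1.
  rewrite invgK -/(left_desc gen i y) => yi; have iP := parabolic_gen gen iK.
  have lt : (len (gen i * y)%g < k)%N.
    by rewrite (leq_trans _ yk) // (cox_len_refl cox) //; exact: reflections_gen.
  rewrite (@right_defect_rec i) ?twisted_desc_WK // !IHk ?mulr0 ?if_same ?addr0 //;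
    exact: parabolicM.
rewrite y1 /right_defect mul1g (@twisted_R_rec j); last first.
  rewrite twisted_desc_WK // /left_desc (inv_parity_gen cox) eqxx //.
have e1 : rd 1%g j = false.
  by rewrite /twisted_rdesc invg1 mulg1 mul1g (twisted_desc_WK (parabolic1 gen K)) //
    /left_desc (inv_parity1 cox).
rewrite e1 gen_sqr // !twisted_R_WK1 //; try exact: parabolicM.
have [->|x1] := eqVneq x 1%g.
  rewrite e1 (twisted_desc_WK (parabolic1 gen K)) //
    /left_desc (inv_parity1 cox) mulg1 mul1g.
  by ring.
have [->|xj] := eqVneq x (gen j).
  by rewrite gen_sqr // eqxx !mulr0 !if_same !addr0 !subr0 subrr.
have -> : (gen j * x == 1)%g = false.
  by rewrite mulg_eq1 eq_sym eqg_invLR (genV cox) (negbTE xj).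
have -> : (x * gen j == 1)%g = false.
  by rewrite mulg_eq1 (genV cox) (negbTE xj).
by rewrite !mulr0 !if_same !addr0 !subr0.
Qed.

Lemma right_defect0 x y : D x y = 0.
Proof.
have [k] : exists k : nat, l y - l x + 1 < k%:Z.
  by exists (absz (l y - l x + 2)); lia.
elim: k x y => [|k IHk] x y lxy.
  (* For [k = 0] the bound says [l x > l y + 1], where the defect vanishes. *)
  by apply: contrapT => /right_defect_len; lia.
have [d [w [dm wK xE]]] := min_rep_exists cox K x.
have [m] := ubnP (len d); elim: m d x y dm xE lxy => // m IHm d x y dm xE lxy.
rewrite ltnS => dk.
have [d1|/(left_desc_ex cox)[i di]] := eqVneq d 1%g.
  have xK : WK x by rewrite xE d1 mul1g.
  have [yK|yNK] := pselect (WK y); first exact: right_defect_parabolic.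
  by apply: contrapT => /right_defect_WK/(_ xK).
have lt : (len (gen i * d)%g < m)%N.
  by rewrite (leq_trans _ dk) // (cox_len_refl cox) //; exact: reflections_gen.
have xi : td x (gen i) = false by rewrite xE twisted_desc_min_rep.
have lx := twisted_len_gen cox K i x; rewrite xi in lx.
have ly := twisted_len_gen cox K i y.
case yi: (td y (gen i)); rewrite yi in ly.
  (* The gap falls by two in the first term and by one in the second. *)
  by rewrite (@right_defect_rec i) // xi !IHk ?mulr0 ?addr0 //; lia.
(* The recursion read backwards: the gap stays, but the minimal part of [gen i * x] is shorter. *)
have := @right_defect_rec i (gen i * x)%g (gen i * y)%g.
rewrite !twisted_desc_genK xi yi !(genK cox) addr0 => <- //.
apply: (IHm (gen i * d)%g) => //; first exact: min_rep_desc.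
  by rewrite xE mulgA.
by lia.
Qed.

Theorem twisted_R_right x y : rd y j = false ->
  R x (y * gen j)%g = R (x * gen j)%g y + (if rd x j then 0 else ab * R x y).
Proof.
move=> yj; have := right_defect0 x y; rewrite /right_defect yj addr0 => /eqP.
by rewrite -addrA -opprD subr_eq0 => /eqP.
Qed.

End TwistedR.

(** * The normalised Kazhdan-Lusztig R-polynomials *)

Section RTilde.
Variables (G : groupType) (I : finType) (gen : I -> G).
Hypothesis cox : is_coxeter_system gen.
Variable R : G -> G -> {poly int}.
Hypothesis RP : is_KL_R gen R.
Local Notation Rt := (Rtilde gen R).
Local Notation ab := (bar alpha).

Lemma Rtilde0 x y : ~ bruhat gen x y -> Rt x y = 0.
Proof. by case: RP => R0 _ _ /R0; rewrite /Rtilde => ->; rewrite rmorph0 mulr0. Qed.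

Lemma Rtilde1 x : Rt x x = 1.
Proof. by case: RP => _ R1 _; rewrite /Rtilde R1 rmorph1 mulr1 addNr expr0z. Qed.

Lemma bar_alpha : ab = Lu^-1 - Lu.
Proof. by rewrite /alpha rmorphB /= rmorphV ?Lu_unit //= bar_Lu invrK. Qed.

(** The normalisation turns the Kazhdan-Lusztig coefficients at [q = u^2] into the twisted ones:
    [q / (-u)^2 = 1] and [(q - 1) / (-u) = bar alpha]. *)
Lemma Rtilde_rec i x y : left_desc gen i y ->
  Rt x y = Rt (gen i * x)%g (gen i * y)%g
           + (if left_desc gen i x then 0 else ab * Rt x (gen i * y)%g).
Proof.
move=> yi; have := cox_len_genl cox i x; have := cox_len_genl cox i y.
have := inv_parity_len_gt0 cox yi.
rewrite -!/(left_desc gen i _) yi => y0 ly lx.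
case: RP => _ _ /(_ x y i); case; first exact/(bruhat_gen cox).
case xi: (left_desc gen i x) lx => lx h1 h2.
  have x0 := inv_parity_len_gt0 cox xi.
  rewrite /Rtilde h1 ?addr0; last exact/(bruhat_gen cox).
  by congr (_ ^ _ * _); lia.
rewrite /Rtilde h2; last by move/(bruhat_gen cox); rewrite xi.
have uu : - Lu \is a GRing.unit by rewrite unitrN Lu_unit.
set e := - _ + _ : int.
have -> : - (cox_len gen (gen i * y)%g)%:Z + (cox_len gen (gen i * x)%g)%:Z
          = e + 1 + 1 by rewrite /e; lia.
have -> : - (cox_len gen (gen i * y)%g)%:Z + (cox_len gen x)%:Z = e + 1 by rewrite /e;
  lia.
rewrite rmorphD !rmorphM rmorphB rmorph1 /= intp_evalX bar_alpha.
clearbody e; rewrite !exprzDr // expr1z.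
have uV : Lu * Lu^-1 = 1 by rewrite mulrV ?Lu_unit.
by ring: uV.
Qed.

End RTilde.

(** * Subwords of reduced words and products with minimal representatives *)

Section BruhatMore.
Variables (G : groupType) (I : finType) (gen : I -> G).
Hypothesis cox : is_coxeter_system gen.
Local Open Scope group_scope.
Local Notation len := (cox_len gen).
Local Notation le := (bruhat gen).

Lemma reduced_cons i w : len (cox_word gen (i :: w)) = size (i :: w) ->
  len (cox_word gen w) = size w /\ ~~ left_desc gen i (cox_word gen w).
Proof.
move=> red; have lw : (len (cox_word gen (i :: w)) <= (len (cox_word gen w)).+1)%N.
  by rewrite cox_word_cons -add1n -(cox_len_gen cox i) (cox_lenM cox).
have redw : len (cox_word gen w) = size w.
  by apply/eqP; rewrite eqn_leq cox_len_word -ltnS -[(size w).+1]red.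
split=> //; rewrite /left_desc -(cox_len_reflN cox); last exact: reflections_gen.
by rewrite -cox_word_cons red redw.
Qed.

Lemma subword_bruhat w w' : len (cox_word gen w) = size w -> subseq w' w ->
  le (cox_word gen w') (cox_word gen w).
Proof.
elim: w w' => [|i w IHw] w' red; first by rewrite subseq0 => /eqP ->; exact: bruhat_refl.
have [redw up] := reduced_cons red.
case: w' => [|j w'] /=; last case: eqP => [->|_] sw.
- move=> _; rewrite cox_word_cons; apply: bruhat_trans (IHw _ redw (sub0seq _)) _.
  by apply/(bruhat_genN cox).
- by rewrite !cox_word_cons; apply: (bruhat_lift_up cox) => //; exact: IHw.
- rewrite (cox_word_cons _ i w); apply: bruhat_trans (IHw _ redw sw) _.
  by apply/(bruhat_genN cox).
Qed.

Lemma bruhat_min_rep_mul K d c c' : is_min_rep gen K d -> parabolic gen K c' ->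
  le c c' -> le (d * c) (d * c').
Proof.
move=> dm c'K; move: c; apply: refl_order_ind_l => [|c t tR lt tc IH].
  exact: bruhat_refl.
apply: bruhat_trans IH.
have tcK : parabolic gen K (t * c) by exact: (bruhat_parabolic cox tc).
have cK : parabolic gen K c.
  apply: (bruhat_parabolic cox) tcK; apply/(bruhat_tr cox) => //.
  by rewrite -(cox_len_reflN cox).
have e : d * (t * c) = d * t * d^-1 * (d * c) by rewrite !gnorm.
rewrite e; apply: refl_order_step; first exact: reflectionsJ.
by rewrite -e !(min_rep_len cox dm) // ltz_nat ltn_add2l.
Qed.

Lemma bruhat_min_rep_le K d c : is_min_rep gen K d -> parabolic gen K c -> le d (d * c).
Proof.
move=> dm cK; rewrite -[X in le X _]mulg1; apply: (bruhat_min_rep_mul dm cK).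
have [w <- red] := reduced_wordP cox c.
rewrite -(cox_word_nil gen); apply: subword_bruhat; [by rewrite red|exact: sub0seq].
Qed.

(* [b * c1^-1] is the smallest element of [b * e^-1] for [e <= c]: each letter
   of [c] either lowers the product or is dropped. *)
Lemma demazure_reduction b c : exists c1, [/\ le c1 c,
  len b = (len (b * c1^-1) + len c1)%N & le (b * c1^-1) (b * c^-1)].
Proof.
have [w <- red] := reduced_wordP cox c.
elim: w red => [|i w IHw] red.
  exists 1; rewrite cox_word_nil invg1 mulg1 cox_len1 addn0.
  by split=> //; exact: bruhat_refl.
have [redw up] := reduced_cons (esym red).
have [c1 [c1c lb bc]] := IHw (esym redw).
have bV x y : le x^-1 y^-1 -> le x y by move/(bruhatV cox); rewrite !invgK.
have bc' : le (c1 * b^-1) (cox_word gen w * b^-1).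
  by have := bruhatV cox bc; rewrite !invgM !invgK.
rewrite cox_word_cons.
have [d|nd] := boolP (left_desc gen i (c1 * b^-1)).
  exists (gen i * c1).
  have l1 : (len (b * (gen i * c1)^-1)).+1 = len (b * c1^-1).
    rewrite -(cox_lenV cox) -[RHS](cox_lenV cox) !invgM !invgK -mulgA (cox_len_genl cox).
    by rewrite -/(left_desc gen i _) d; have := inv_parity_len_gt0 cox d; case: (len _).
  have l2 : len (gen i * c1) = (len c1).+1.
    (* The first factor has lost one letter, so subadditivity for
       [b = (b * (gen i * c1)^-1) * (gen i * c1)] forces the second to gain one. *)
    apply/eqP; rewrite eqn_leq -{1}add1n -{1}(cox_len_gen cox i) (cox_lenM cox) /=.
    rewrite -(leq_add2l (len (b * (gen i * c1)^-1))) addnS -addSn l1 -lb.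
    by have := cox_lenM cox (b * (gen i * c1)^-1) (gen i * c1); rewrite mulgVK.
  split.
  - exact: (bruhat_lift_up cox).
  - by rewrite l2 lb -l1 addnS.
  - apply: bV; rewrite !invgM !invgK -!mulgA; exact: (bruhat_lift_down cox).
exists c1; split=> //.
- apply: bruhat_trans c1c _; exact/(bruhat_genN cox).
- apply: bV; rewrite !invgM !invgK -!mulgA; exact: (bruhat_lift_x_y cox).
Qed.

End BruhatMore.

(** * Products of the theta(r_i) *)

Section HatSystem.
Variables (n : nat) (W What : groupType) (r : 'I_n -> W).
Variables (iota : {multiplicative W -> What}) (theta : 'I_n -> What).
Hypothesis hat : is_hat_system r iota theta.
Local Open Scope group_scope.
Local Notation gen := (hat_gen r iota theta).

Let coxW : is_coxeter_system r. Proof. by case: hat. Qed.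
Let coxH : is_coxeter_system gen. Proof. by case: hat. Qed.
Let iota_inj : injective iota. Proof. by case: hat. Qed.
Let theta_comm i j : ~ commute (iota (r i)) (theta j) <-> i = j.
Proof. by case: hat. Qed.

Definition inl_set : {set 'I_n + 'I_n} := [set k | if k is inl _ then true else false].
Local Notation K := inl_set.
Local Notation WK := (parabolic gen K).
Local Notation lenW := (cox_len r).
Local Notation len := (cox_len gen).

Lemma iotaM x y : iota (x * y) = iota x * iota y.
Proof. exact: gmulfM. Qed.

Lemma iota1 : iota 1 = 1.
Proof. by apply: (mulgI (iota 1)); rewrite -iotaM !mulg1. Qed.

Lemma iotaV x : iota x^-1 = (iota x)^-1.
Proof. by apply/esym/mulg1_eq; rewrite -iotaM mulgV iota1. Qed.

Lemma cox_word_inl w : cox_word gen [seq inl i | i <- w] = iota (cox_word r w).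
Proof.
elim: w => [|i w IHw]; first by rewrite !cox_word_nil iota1.
by rewrite /= !cox_word_cons IHw iotaM.
Qed.

Lemma mem_inl_set w : all (fun k => k \in K) w ->
  exists w', w = [seq inl i | i <- w'].
Proof.
elim: w => [|[i|i] w IHw] /=; first by exists [::].
  by rewrite inE /= => /IHw[w' ->]; exists (i :: w').
by rewrite inE.
Qed.

Lemma iota_WK x : WK (iota x).
Proof.
have [w <-] := cox_wordP coxW x; exists [seq inl i | i <- w]; last exact: cox_word_inl.
by apply/allP => _ /mapP[i _ ->]; rewrite inE.
Qed.

Lemma WK_iota x : WK x -> exists y, x = iota y.
Proof.
by case=> w /mem_inl_set[w' ->] <-; exists (cox_word r w'); rewrite cox_word_inl.
Qed.

(** Brings [A] into the form treated above, with [W] as the parabolic subgroup of the indices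
    [inl i]. *)
Lemma hat_AE : hat_A r iota theta = (reflections gen `\` parabolic gen K)%classic.
Proof.
congr (_ `\` _)%classic; apply/seteqP; split=> x; first by case=> y _ <-; exact: iota_WK.
by case/WK_iota => y ->; exists y.
Qed.

Lemma len_iota x : len (iota x) = lenW x.
Proof.
apply/eqP; rewrite eqn_leq; apply/andP; split.
  have [w <- <-] := reduced_wordP coxW x.
  by rewrite -cox_word_inl (leq_trans (cox_len_word _ _)) ?size_map.
have [w [/mem_inl_set[w' ->]]] := parabolic_reduced coxH (iota_WK x).
by rewrite cox_word_inl => /iota_inj <- <-; rewrite size_map cox_len_word.
Qed.

(** A reflection is an inversion of itself; for [iota t] this can be computed from a word of [t] in
    [W], and every inversion is a reflection. *)
Lemma refl_iota t : reflections gen (iota t) <-> reflections r t.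
Proof.
split=> [tR|[g [i ->]]]; last first.
  by exists (iota g), (inl i); rewrite !iotaM iotaV.
have [w wt] := cox_wordP coxW t; apply: (@inv_parity_reflection _ _ _ coxW t t).
have := inv_parity_refl coxH tR; rewrite -{1}wt -cox_word_inl.
rewrite (inv_parityE coxW _ wt) (inv_parityE coxH _ erefl) /word_parity.
have -> : prefix_refls gen [seq inl i | i <- w] = [seq iota u | u <- prefix_refls r w].
  elim: w {wt} => //= i w ->; congr (_ :: _).
  by rewrite -!map_comp; apply: eq_map => u /=; rewrite -iotaV -!iotaM.
rewrite count_map; congr (is_true (odd _)); apply: eq_count => u /=.
exact: inj_eq.
Qed.

Lemma bruhat_iota x y : bruhat gen (iota x) (iota y) <-> bruhat r x y.
Proof.
split; last first.
  move: x; apply: refl_order_ind_l => [|x t tR lt _]; first exact: bruhat_refl.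
  apply: bruhat_trans; rewrite iotaM; apply: refl_order_step; first exact/refl_iota.
  by rewrite -iotaM !len_iota.
suff h z : bruhat gen z (iota y) -> forall x, z = iota x -> bruhat r x y.
  by move=> /h; apply.
move: z {x}; apply: refl_order_ind_l => [x /iota_inj ->|z t tR lt tz IH x zx].
  exact: bruhat_refl.
have [u tzu] := WK_iota (bruhat_parabolic coxH tz (iota_WK y)).
have tE : t = iota (u * x^-1) by rewrite iotaM iotaV -tzu zx mulgK.
apply: bruhat_trans (IH u tzu); rewrite -[u](mulgVK x); apply: refl_order_step.
  by apply/refl_iota; rewrite -tE.
by rewrite mulgVK -!len_iota -tzu -zx.
Qed.

Definition theta_prod (L : seq 'I_n) : What := cox_word gen [seq inr i | i <- L].

Lemma theta_prod_cons i L : theta_prod (i :: L) = theta i * theta_prod L.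
Proof. by rewrite /theta_prod /= cox_word_cons. Qed.

Lemma theta_prod_cat L M : theta_prod (L ++ M) = theta_prod L * theta_prod M.
Proof. by rewrite /theta_prod map_cat cox_word_cat. Qed.

Definition compl_enum (J : {set 'I_n}) :
  seq 'I_n := [seq i <- index_enum 'I_n | i \notin J].

Lemma z_compl_enum J : z_ theta J = theta_prod (compl_enum J).
Proof. by rewrite /z_ /theta_prod /cox_word big_map big_filter. Qed.

Lemma compl_enum_uniq J : uniq (compl_enum J).
Proof. by rewrite filter_uniq // index_enum_uniq. Qed.

Lemma mem_compl_enum J i : (i \in compl_enum J) = (i \notin J).
Proof. by rewrite mem_filter mem_index_enum andbT. Qed.

Lemma size_compl_enum J : (size (compl_enum J) + #|J| = n)%N.
Proof.
rewrite -[RHS]card_ord -(cardC (mem J)) addnC; congr (_ + _)%N.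
by rewrite cardE /enum_mem /compl_enum [index_enum _]unlock; congr size; apply: eq_filter.
Qed.

Lemma theta_prod_parabolic (J : {set 'I_n + 'I_n}) L :
  all (fun i => inr i \in J) L -> parabolic gen J (theta_prod L).
Proof. by move=> LJ; exists [seq inr i | i <- L]; rewrite // all_map. Qed.

Lemma theta_prod_theta_parabolic L :
  parabolic gen [set k | if k is inr i then i \in L else false] (theta_prod L).
Proof. by apply: theta_prod_parabolic; apply/allP => i iL; rewrite inE. Qed.

Lemma parabolicS (J J' : {set 'I_n + 'I_n}) x :
  J \subset J' -> parabolic gen J x -> parabolic gen J' x.
Proof. by move/fintype.subsetP => JJ [w wJ <-]; exists w => //;
  apply: sub_all wJ => i /JJ. Qed.

(** When the letter [inr i] is appended, the product so far lies in a parabolic subgroup without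
    that index, so the length goes up. *)
Lemma len_theta_prod x (L : seq 'I_n) : WK x -> uniq L ->
  len (x * theta_prod L) = (len x + size L)%N.
Proof.
move=> xK; elim/last_ind: L => [|L i IHL];
  first by rewrite /theta_prod cox_word_nil mulg1 addn0.
rewrite rcons_uniq => /andP[iL uL];
  rewrite -cats1 theta_prod_cat mulgA size_cat addn1 addnS.
rewrite [theta_prod [:: i]]cox_word1 (cox_len_genr coxH) IHL //.
rewrite (@parabolic_notin _ _ _ coxH
  (K :|: [set k | if k is inr i then i \in L else false])) //.
  apply: parabolicV => //; apply: parabolicM.
    by apply: parabolicS xK; exact: finset.subsetUl.
  by apply: parabolicS (theta_prod_theta_parabolic L); exact: finset.subsetUr.
by rewrite !inE (negbTE iL).
Qed.

Lemma theta_prod_comm s L : s \notin L ->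
  iota (r s) * theta_prod L = theta_prod L * iota (r s).
Proof.
elim: L => [|i L IHL]; first by rewrite /theta_prod cox_word_nil mulg1 mul1g.
rewrite inE negb_or theta_prod_cons => /andP[/eqP si sL].
have si' : commute (iota (r s)) (theta i) by apply: contrapT => /theta_comm.
by rewrite mulgA si' -!mulgA IHL.
Qed.

Lemma compl_enum_comm J c : parabolic r J c ->
  iota c * theta_prod (compl_enum J) = theta_prod (compl_enum J) * iota c.
Proof.
case=> w wJ <-; elim: w wJ => [|i w IHw] /=;
  first by rewrite cox_word_nil iota1 mulg1 mul1g.
move=> /andP[iJ /IHw e]; rewrite cox_word_cons iotaM -mulgA e !mulgA theta_prod_comm //.
by rewrite mem_compl_enum iJ.
Qed.

(** The letters other than [theta s] commute with [r s] and can be cancelled, which would leave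
    [r s] commuting with [theta s]. *)
Lemma theta_prod_noncomm s L : s \in L -> uniq L ->
  iota (r s) * theta_prod L <> theta_prod L * iota (r s).
Proof.
move=> sL; case/splitPr: sL => L1 L2.
rewrite uniq_catC /= mem_cat negb_or => /andP[/andP[s2 s1] _] e.
suff : commute (iota (r s)) (theta s) by have /theta_comm := erefl s.
move: e; rewrite theta_prod_cat theta_prod_cons.
rewrite mulgA theta_prod_comm // -!mulgA -theta_prod_comm // => /mulgI.
by rewrite !mulgA => /mulIg.
Qed.

Lemma min_rep_theta_prod a L : uniq L -> is_min_rep r [set i | i \notin L] a ->
  is_min_rep gen K (iota a * theta_prod L).
Proof.
move=> uL am; apply/(min_rep_descP coxH) => -[s _|s]; last by rewrite inE.
apply/negbTE; apply/negP => sx.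
have [sL|sL] := boolP (s \in L); last first.
  have := sx; rewrite -(cox_len_refl coxH); last exact: reflections_gen.
  rewrite -[X in (_ < X)%N](cox_lenV coxH) -(cox_lenV coxH) invgM !invgK (genV coxH) /=.
  rewrite -mulgA -theta_prod_comm //
    mulgA -iotaM !(len_theta_prod (iota_WK _) uL) !len_iota ltn_add2r.
  rewrite (min_rep_len coxW am) ?(cox_len_gen coxW) ?addn1 ?ltnNge ?leqnSn //.
  by apply: parabolic_gen; rewrite inE.
(* For [s] in [L], a descent would put [theta_prod L * r_s * (theta_prod L)^-1] in [W]. Its length
   makes it a simple reflection, its support makes it [r s], and this contradicts
   [theta_prod_noncomm]. *)
have thV := parabolicV coxH (theta_prod_theta_parabolic L).
move: sx; rewrite invgM (inv_parityM coxH) invgK (parabolic_notin coxH thV) ?inE // addFb.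
set u := _ * _ * _ => ua.
have [v uv] := WK_iota (parabolic_inv coxH (parabolicV coxH (iota_WK a)) ua).
have vth : iota v * theta_prod L = theta_prod L * iota (r s) by rewrite -uv /u mulgVK.
have sth : len (theta_prod L * iota (r s)) = (size L).+1.
  rewrite (cox_len_genr coxH (inl s)) (parabolic_notin coxH thV) ?inE //.
  by rewrite -[theta_prod L]mul1g (len_theta_prod (parabolic1 gen K) uL) cox_len1.
have lv : lenW v = 1%N.
  apply/eqP; rewrite -len_iota -(eqn_add2r (size L)) -(len_theta_prod (iota_WK _) uL) vth sth add1n.
  by [].
have [w wv sw] := reduced_wordP coxW v.
case: w wv sw => [|s' [|? ?]]; rewrite lv // => wv _.
have vE : v = r s' by rewrite -wv cox_word1.
have : s' = s.
  have : parabolic gen (inl s |: [set k | if k is inr i then i \in L else false])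
    (iota v).
    have -> : iota v = theta_prod L * iota (r s) *
      (theta_prod L)^-1 by rewrite -vth mulgK.
    have th' := parabolicS (finset.subsetUr [set inl s] _) (theta_prod_theta_parabolic L).
    apply: parabolicM => //; last exact: parabolicV.
    apply: parabolicM => //; apply: (@parabolic_gen _ _ gen _ (inl s)).
    by rewrite !inE eqxx.
  rewrite vE => /(@gen_parabolic _ _ _ coxH _ (inl s')).
  by rewrite !inE orbF => /eqP[].
move=> ss'; move: vth; rewrite vE ss'; exact: theta_prod_noncomm.
Qed.

Lemma bruhat_theta_prod_sub e a L : bruhat gen e (iota a * theta_prod L) ->
  exists a' L', [/\ e = iota a' * theta_prod L', bruhat r a' a & subseq L' L].
Proof.
have [w wa red] := reduced_wordP coxW a.
have -> : iota a * theta_prod L = cox_word gen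
  ([seq inl i | i <- w] ++ [seq inr i | i <- L]).
  by rewrite cox_word_cat cox_word_inl wa.
move=> /(bruhat_subword coxH)[w' /subseqP[m sm ->] <-].
set m1 := take (size w) m; set m2 := drop (size w) m.
have sm1 : size m1 = size w.
  rewrite size_take sm size_cat !size_map; case: ltnP => //.
  by rewrite -{2}[size w]addn0 leq_add2l leqn0 => /eqP ->; rewrite addn0.
exists (cox_word r (mask m1 w)), (mask m2 L); split.
- rewrite -cox_word_inl -cox_word_cat !map_mask -mask_cat ?size_map //.
  by rewrite cat_take_drop.
- by rewrite -wa; apply: subword_bruhat => //; rewrite ?mask_subseq // wa red.
- exact: mask_subseq.
Qed.

Lemma bruhat_theta_prod a' a L' L : bruhat r a' a -> uniq L -> subseq L' L ->
  bruhat gen (iota a' * theta_prod L') (iota a * theta_prod L).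
Proof.
have [w wa red] := reduced_wordP coxW a;
  rewrite -wa => /(bruhat_subword coxW)[w' sw <-] uL sL.
rewrite -!cox_word_inl -!cox_word_cat; apply: (subword_bruhat coxH).
  rewrite cox_word_cat cox_word_inl (len_theta_prod (iota_WK _) uL) len_iota wa -red.
  by rewrite size_cat !size_map.
by apply: cat_subseq; exact: map_subseq.
Qed.

Lemma subseq_compl_enum (J J' : {set 'I_n}) : J \subset J' ->
  subseq (compl_enum J') (compl_enum J).
Proof.
move=> JJ; rewrite (_ : compl_enum J' = [seq i <- compl_enum J | i \notin J']) ?filter_subseq //.
rewrite -filter_predI; apply: eq_filter => i /=; case: (boolP (i \in J')) => //= iJ.
by apply/esym; apply: contra iJ => /(fintype.subsetP JJ).
Qed.

(** All these lists are filtered from one enumeration, so deleting letters from some [z_J] gives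
    another element of the same kind. This keeps upward steps inside [Omega]. *)
Lemma subseq_compl_enumP J L : subseq L (compl_enum J) ->
  exists2 J' : {set 'I_n}, J \subset J' & L = compl_enum J'.
Proof.
move=> sL; exists [set i | i \notin L]%SET.
  apply/fintype.subsetP => i iJ; rewrite inE.
  by apply/negP => /(mem_subseq sL); rewrite mem_compl_enum iJ.
rewrite {1}((subseq_uniqP (compl_enum_uniq J)) sL) /compl_enum -filter_predI;
  apply: eq_filter => i /=.
rewrite inE negbK; case: (boolP (i \in L)) => //= /(mem_subseq sL).
by rewrite mem_compl_enum.
Qed.

(** Membership of [s] in [J] is detected by whether [r s] commutes with [z_J]. *)
Lemma theta_prod_compl_enum_inj J J' :
  theta_prod (compl_enum J) = theta_prod (compl_enum J') -> J = J'.
Proof.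
suff sub J1 J2 : theta_prod (compl_enum J1) = theta_prod (compl_enum J2) -> J1 \subset J2.
  by move=> e; apply/eqP; rewrite finset.eqEsubset !sub.
move=> e; apply/fintype.subsetP => s s1; apply: contraT => s2.
have sL : s \in compl_enum J2 by rewrite mem_compl_enum.
have ns : s \notin compl_enum J1 by rewrite mem_compl_enum s1.
by have := theta_prod_noncomm sL (compl_enum_uniq J2); rewrite -e theta_prod_comm.
Qed.

End HatSystem.

(** * The isomorphism from V to Omega *)

Section HatOrder.
Variables (n : nat) (W What : groupType) (r : 'I_n -> W).
Variables (iota : {multiplicative W -> What}) (theta : 'I_n -> What).
Hypothesis hat : is_hat_system r iota theta.
Local Open Scope group_scope.
Local Notation gen := (hat_gen r iota theta).
Let coxW : is_coxeter_system r. Proof. by case: hat. Qed.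
Let coxH : is_coxeter_system gen. Proof. by case: hat. Qed.
Let iota_inj : injective iota. Proof. by case: hat. Qed.
Local Notation K := (inl_set n).
Local Notation WK := (parabolic gen K).
Local Notation lenW := (cox_len r).
Local Notation len := (cox_len gen).
Local Notation A := (reflections gen `\` parabolic gen K)%classic.
Local Notation l := (twisted_len gen A).
Local Notation le := (twisted_le gen A).
Local Notation f := (@phi n W What r iota theta).
Local Notation zz J := (theta_prod r iota theta (compl_enum J)).

Lemma va_min (v : Vset r) : is_min_rep r (vI v) (va v).
Proof. by apply/(min_coset_repsE coxW); exact: (set_valP v). Qed.

Definition V_triple J a b (h : is_min_rep r J a) : Vset r :=
  exist _ (J, a, b) (mem_set (proj2 (min_coset_repsE coxW J a) h)).

Lemma Vset_inj (v w : Vset r) : vI v = vI w -> va v = va w -> vb v = vb w -> v = w.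
Proof.
rewrite /vI /va /vb => e1 e2 e3; apply: val_inj.
by case: (val v) (val w) e1 e2 e3 => [[? ?] ?] [[? ?] ?] /= -> -> ->.
Qed.

Lemma phiE v : f v = iota (va v) * zz (vI v) * iota (vb v)^-1.
Proof. by rewrite /phi (z_compl_enum r iota). Qed.

Lemma phi_min J a : is_min_rep r J a -> is_min_rep gen K (iota a * zz J).
Proof.
move=> am; apply: (min_rep_theta_prod hat); first exact: compl_enum_uniq.
suff -> : [set i | i \notin compl_enum J]%SET = J by [].
by apply/setP => i; rewrite inE mem_compl_enum negbK.
Qed.

Lemma phi_len v : l (f v) = (V_dim v - n%:Z)%R.
Proof.
rewrite phiE (twisted_lenE coxH (phi_min (@va_min v)) (iota_WK hat _)).
rewrite (len_theta_prod hat (iota_WK hat _) (compl_enum_uniq _)) !(len_iota hat)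
  (cox_lenV coxW).
by have := size_compl_enum (vI v); rewrite /V_dim; lia.
Qed.

Lemma phi_inj : injective f.
Proof.
move=> v w; rewrite !phiE => e.
have [e1 e2] := min_rep_uniq coxH (phi_min (@va_min v)) (phi_min (@va_min w))
  (iota_WK hat _) (iota_WK hat _) e.
have {e2} eb : vb v = vb w by apply: invg_inj; exact: iota_inj.
have lz a J : len (iota a * zz J) = (lenW a + size (compl_enum J))%N.
  by rewrite (len_theta_prod hat (iota_WK hat _) (compl_enum_uniq _)) (len_iota hat).
(* Lengths in this equation and in its mirror image [zE'] add up to
   [len (a^-1 a') + len (a'^-1 a) = 0], hence [a = a']. *)
have zE : zz (vI v) = iota ((va v)^-1 * va w) * zz (vI w).
  by rewrite (iotaM iota) (iotaV iota) -mulgA -e1 mulKg.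
have l1 := lz 1 (vI v); have l2 := lz ((va v)^-1 * va w) (vI w).
have l3 := lz 1 (vI w); have l4 := lz ((va w)^-1 * va v) (vI v).
rewrite -zE in l2; rewrite (iota1 iota) !mul1g !cox_len1 in l1 l3.
have zE' : zz (vI w) = iota ((va w)^-1 * va v) * zz (vI v).
  by rewrite (iotaM iota) (iotaV iota) -mulgA e1 mulKg.
rewrite -zE' in l4.
have eW : (va v)^-1 * va w = 1 by apply: (len_le1 coxW); lia.
have ea : va v = va w by rewrite -[RHS](mulVKg (va v)) eW mulg1.
apply: Vset_inj => //; apply: (theta_prod_compl_enum_inj hat).
by rewrite zE eW (iota1 iota) mul1g.
Qed.

Lemma phi_val (v : Vset r) J a b : val v = (J, a, b) ->
  f v = iota a * zz J * iota b^-1.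
Proof. by rewrite phiE /vI /va /vb => ->. Qed.

(** The part of [a] in [W_J] commutes with [z_J] and is moved across into [b]. *)
Lemma phi_normal J a b : exists v c, [/\ vI v = J, parabolic r J c,
  a = va v * c, vb v = b * c^-1 & f v = iota a * zz J * iota b^-1].
Proof.
have [a' [c [am cJ aE]]] := min_rep_exists coxW J a.
exists (V_triple (b * c^-1) am), c; split=> //.
rewrite phiE /V_triple /vI /va /vb /= aE (iotaM iota) invgM invgK (iotaM iota).
by rewrite -[X in _ = X * _]mulgA (compl_enum_comm hat cJ) !mulgA.
Qed.

(* One step of type 2 followed by one of type 1. *)
Lemma V_le_delete (v : Vset r) (J : {set 'I_n}) a :
  vI v \subset J -> bruhat r a (va v) ->
  exists2 w, f w = iota a * zz J * iota (vb v)^-1 & V_le v w.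
Proof.
move=> vJ av; have [w [c [wJ cJ aE wb fw]]] := phi_normal J a (vb v).
(* Type 2 demands that lengths add, which [c] itself may violate. It is applied with [c1], and type
   1 then raises [b * c1^-1] to [b * c^-1]. *)
exists w => //; have [c1 [c1c lb bb]] := demazure_reduction coxW (vb v) c.
have wm : is_min_rep r J (va w) by rewrite -wJ; exact: va_min.
have c1J := bruhat_parabolic coxW c1c cJ.
pose m := V_triple (vb v * c1^-1) wm.
have mI : vI m = J by [].
have ma : va m = va w by [].
have mb : vb m = vb v * c1^-1 by [].
apply: (rt_trans _ _ _ m); apply: rt_step; [right|left].
  rewrite /V_le2 mI ma mb; split=> //; exists c1; split=> //.
    by rewrite mulgVK.
  by apply: bruhat_trans av; rewrite aE; exact: (bruhat_min_rep_mul coxW wm).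
by split; rewrite ?mI ?ma ?mb ?wJ ?wb //; exact: bruhat_refl.
Qed.

Lemma twisted_le_V v y : le (f v) y -> exists2 w, f w = y & V_le v w.
Proof.
move: y; apply: refl_order_ind_r => [|z t tR lt _ [w fw vw]]; last rewrite -fw in lt *.
  by exists v => //; exact: rt_refl.
suff [w' fw' ww'] : exists2 w', f w' = t * f w & V_le w w'.
  by exists w' => //; apply: rt_trans ww'.
have nd : twisted_desc gen K (f w) t = false.
  by apply/negbTE; rewrite -(twisted_descN coxH).
rewrite phiE in nd *.
have := twisted_step_cases coxH (phi_min (@va_min w)) (iota_WK hat _) tR nd.
case=> [[w' w'K [-> [bw _]]]|[-> [td _]]].
  have [b bE] := WK_iota w'K; rewrite bE in bw *.
  exists (V_triple b^-1 (@va_min w));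
    first by rewrite phiE /V_triple /vI /va /vb /= invgK.
  apply: rt_step; left; split; rewrite /V_triple /vI /va /vb //=;
    first exact: bruhat_refl.
  rewrite -[X in bruhat _ X _]invgK; apply: (bruhatV coxW).
  exact/(bruhat_iota hat).
have [a [L [e ba sL]]] := bruhat_theta_prod_sub hat td.
have [J wJ LE] := subseq_compl_enumP sL.
rewrite e LE; exact: V_le_delete.
Qed.

Lemma V_le_twisted v w : V_le v w -> le (f v) (f w).
Proof.
elim=> {v w} [v w vw|v|v u w _ h1 _ h2]; last 2 first.
- exact: twisted_refl.
- exact: twisted_trans h1 h2.
have vm := phi_min (@va_min v); rewrite !phiE.
case: vw => [[vI_w va_w vb_w]|[vI_w [c [cJ vbE _ va_w]]]].
  have sz := subseq_compl_enum vI_w.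
  apply: (twisted_trans (y := iota (va v) * zz (vI v) * iota (vb w)^-1)).
    apply: (twisted_le_parabolic coxH vm (iota_WK hat _)).
    by apply/(bruhat_iota hat); exact: (bruhatV coxW).
  apply: (twisted_le_min coxH vm (iota_WK hat _)).
  exact: (bruhat_theta_prod hat va_w (compl_enum_uniq _) (subseq_compl_enum vI_w)).
(* Since [c] commutes with [z_J], both elements can be written with the same factor in [W] on the
   right, and only the left parts are compared. *)
have -> : iota (va w) * zz (vI w) * iota (vb w)^-1 =
          iota (va w * c) * zz (vI w) * iota (vb v)^-1.
  rewrite vbE invgM (iotaM iota (va w) c) -[X in _ = X * _]mulgA (compl_enum_comm hat cJ).
  by rewrite !(iotaM iota) !(iotaV iota) !mulgA mulgK.
apply: (twisted_le_min coxH vm (iota_WK hat _)).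
exact: (bruhat_theta_prod hat va_w (compl_enum_uniq _) (subseq_compl_enum vI_w)).
Qed.

Lemma phi_iso v w : V_le v w <-> le (f v) (f w).
Proof.
split; first exact: V_le_twisted.
by case/twisted_le_V => w' /phi_inj ->.
Qed.

Lemma Omega_phi x : Omega iota theta x <-> exists v, f v = x.
Proof.
split=> [[J [a [b ->]]]|[v <-]]; last by exists (vI v), (va v), (vb v)^-1.
have [v [c [_ _ _ _ fv]]] := phi_normal J a b^-1.
by exists v; rewrite fv invgK -(z_compl_enum r iota).
Qed.

Lemma phi_bij : set_bij [set: Vset r] (Omega iota theta) f.
Proof.
split=> [v _|v w _ _ /phi_inj//|x /Omega_phi[v <-]]; last by exists v.
by apply/Omega_phi; exists v.
Qed.

Lemma Omega_up x y : Omega iota theta x -> le x y -> Omega iota theta y.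
Proof. by move=> /Omega_phi[v <-] /twisted_le_V[w <- _]; apply/Omega_phi; exists w. Qed.

(** * The action of W x W under phi *)

Section Action.
Variable act : W * W -> Vset r -> Vset r.
Hypothesis actP : is_V_action act.

Lemma phi_act a b v : f (act (a, b) v) = iota a * f v * (iota b)^-1.
Proof.
case: actP => act1 actM act_r act_l1 act_l2.
have gl i u : f (act (r i, 1) u) = iota (r i) * f u.
  have [h|[j jI e]] := deodhar coxW i (@va_min u).
    have /phi_val -> := act_l1 i u (proj2 (min_coset_repsE coxW _ _) h).
    by rewrite phiE (iotaM iota) !mulgA.
  have up : bruhat r (va u) (r i * va u).
    rewrite e; exact: (bruhat_min_rep_le coxW (@va_min u) (parabolic_gen r jI)).
  have /phi_val -> := act_l2 i j u up jI e.
  rewrite phiE invgM (genV coxW) (iotaM iota) !mulgA; congr (_ * _).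
  by rewrite -[LHS]mulgA -(compl_enum_comm hat (parabolic_gen r jI)) mulgA -!(iotaM iota) e.
have gr i u : f (act (1, r i) u) = f u * iota (r i).
  by have /phi_val -> := act_r i u; rewrite phiE invgM (genV coxW) (iotaM iota) !mulgA.
have hl u : f (act (a, 1) u) = iota a * f u.
  have [w <-] := cox_wordP coxW a; elim: w u => [|i w IHw] u.
    by rewrite cox_word_nil act1 (iota1 iota) mul1g.
  have -> : (cox_word r (i :: w), 1) = (r i, 1) * (cox_word r w, 1) :> W * W.
    by rewrite cox_word_cons; congr pair; rewrite mulg1.
  by rewrite actM gl IHw cox_word_cons (iotaM iota) mulgA.
have hr u : f (act (1, b) u) = f u * (iota b)^-1.
  have [w <-] := cox_wordP coxW b; elim: w u => [|i w IHw] u.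
    by rewrite cox_word_nil act1 (iota1 iota) invg1 mulg1.
  have -> : (1, cox_word r (i :: w)) = (1, r i) * (1, cox_word r w) :> W * W.
    by rewrite cox_word_cons; congr pair; rewrite mulg1.
  rewrite actM gr IHw cox_word_cons (iotaM iota) invgM mulgA.
  by rewrite -(iotaV iota (r i)) (genV coxW).
have -> : (a, b) = (a, 1) * (1, b) :> W * W by congr pair; rewrite ?mulg1 ?mul1g.
by rewrite actM hl hr mulgA.
Qed.

End Action.
End HatOrder.

(** * Springer's polynomials *)

Section HatR.
Variables (n : nat) (W What : groupType) (r : 'I_n -> W).
Variables (iota : {multiplicative W -> What}) (theta : 'I_n -> What).
Hypothesis hat : is_hat_system r iota theta.
Local Notation gen := (hat_gen r iota theta).
Let coxW : is_coxeter_system r. Proof. by case: hat. Qed.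
Let coxH : is_coxeter_system gen. Proof. by case: hat. Qed.
Local Notation K := (inl_set n).
Local Notation WK := (parabolic gen K).
Local Notation lenW := (cox_len r).
Local Notation len := (cox_len gen).
Local Notation A := (reflections gen `\` parabolic gen K)%classic.
Local Notation l := (twisted_len gen A).
Local Notation le := (twisted_le gen A).
Local Notation td := (twisted_desc gen K).
Local Notation rd := (twisted_rdesc gen K).
Local Notation f := (@phi n W What r iota theta).
Local Notation th := (theta_prod r iota theta).
Local Notation zz J := (th (compl_enum J)).
Local Notation ab := (bar alpha).

Variable R : W -> W -> {poly int}.
Hypothesis RP : is_KL_R r R.
Local Notation Rt := (Rtilde r R).
Variable RA : What -> What -> laurent.
Hypothesis RAP : is_twisted_R gen A RA.

Let RA_rec := twisted_R_rec coxH RAP.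

(** At [vb w = 1] this is the support condition in Springer's (b). The quantifier over all [J]
    containing [vI w] allows chains to be composed. *)
Lemma V_le_sub (v w : Vset r) : V_le v w ->
  vI v \subset vI w /\
  forall J : {set 'I_n}, vI w \subset J -> parabolic r J (vb w) -> parabolic r J (vb v).
Proof.
elim=> {v w} [v w [[sI _ vbw]|[sI [c [cJ -> _ _]]]]|v|v u w _ [s1 p1] _ [s2 p2]] //.
- by split=> // J _; exact: (bruhat_parabolic coxW vbw).
- split=> // J /fintype.subsetP sJ wJ; apply: parabolicM => //.
  by case: cJ => x xw <-; exists x => //; apply: sub_all xw => i /sJ.
- split; first exact: fintype.subset_trans s1 s2.
  by move=> J sJ /(p2 _ sJ) uJ; apply: p1 => //; exact: fintype.subset_trans s2 sJ.
Qed.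

Lemma V_le_va1 (v w : Vset r) : V_le v w -> va v = 1%g ->
  va w = 1%g /\ bruhat r (vb v) (vb w).
Proof.
elim=> {v w} [v w [[_ avw vbw]|[_ [c [cJ -> _ avw]]]]|v|v u w _ h1 _ h2] v1.
- by rewrite v1 in avw; rewrite (bruhat_le1 avw).
- rewrite v1 in avw; have e := bruhat_le1 avw.
  have [w1 c1] : va w = 1%g /\ c = 1%g.
    have := min_rep_len coxW (@va_min _ _ _ _ _ _ hat w) cJ; rewrite e cox_len1.
    by move=> h; split; apply: (len_le1 coxW); lia.
  by rewrite w1 c1 mulg1; split=> //; exact: bruhat_refl.
- by split=> //; exact: bruhat_refl.
- have [u1 vu] := h1 v1; have [w1 uw] := h2 u1.
  by split=> //; exact: bruhat_trans vu uw.
Qed.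

Lemma left_desc_theta_prod s a (L : seq 'I_n) : uniq L ->
  left_desc gen (inl s) (iota a * th L)%g = left_desc r s a.
Proof.
move=> uL; rewrite /left_desc -(cox_len_refl coxH); last exact: reflections_gen.
rewrite -(cox_len_refl coxW); last exact: reflections_gen.
rewrite mulgA /= -(iotaM iota) !(len_theta_prod hat (iota_WK hat _) uL) !(len_iota hat).
by rewrite ltn_add2r.
Qed.

Lemma theta_prod_min (L : seq 'I_n) : uniq L -> is_min_rep gen K (th L).
Proof.
move=> uL; rewrite -[th L]mul1g -(iota1 iota); apply: (min_rep_theta_prod hat) => //.
exact: min_rep1.
Qed.

Lemma twisted_desc_theta_prod s (L : seq 'I_n) : uniq (s :: L) ->
  td (th (s :: L)) (gen (inr s)) = false.
Proof.
move=> uL; rewrite -[th _]mulg1; apply: (twisted_desc_min_rep coxH).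
- exact: theta_prod_min.
- exact: parabolic1.
rewrite /left_desc -(cox_len_refl coxH); last exact: reflections_gen.
have lt (M : seq 'I_n) : uniq M -> len (th M) = size M.
  by move=> uM; rewrite -[th M]mul1g (len_theta_prod hat (parabolic1 gen K)) // cox_len1.
rewrite [in X in (_ < X)%N]lt // theta_prod_cons (genK coxH (inr s)) lt //.
by case/andP: uL.
Qed.

(** A leading letter common to both is stripped. A leading [s] of [L] that is missing in [M] is a
    twisted descent of [theta_prod M] only, and the recursion there yields one factor
    [bar alpha]. *)
Lemma twisted_R_theta_prod (L M : seq 'I_n) : uniq L -> subseq M L ->
  RA (th L) (th M) = ab ^+ (size L - size M).
Proof.
elim: L M => [|s L IHL] M uL.
  by rewrite subseq0 => /eqP ->; rewrite (twisted_R1 coxH RAP).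
have uL' : uniq L by case/andP: uL.
have sL : s \notin L by case/andP: uL.
have both N : uniq (s :: N) -> RA (th (s :: L)) (th (s :: N)) = RA (th L) (th N).
  move=> uN; have e (P : seq 'I_n) : th P = (gen (inr s) * th (s :: P))%g.
    by rewrite theta_prod_cons (genK coxH (inr s)).
  rewrite (e L) (e N) [RHS](RA_rec (i := inr s))
    ?(twisted_desc_genK coxH) ?twisted_desc_theta_prod // addr0.
  by rewrite !(genK coxH).
have uN N : subseq N L -> uniq (s :: N).
  move=> sN; rewrite /= (subseq_uniq sN) // andbT.
  by apply: contra sL; exact: mem_subseq.
move=> sM; have [{}sM|[M' ME sM']] : subseq M L \/ exists2 M', M = s :: M' & subseq M' L.
- case: M sM => [|t M] /=; first by left; exact: sub0seq.
  by case: eqP => [->|_] sM; [right; exists M|left].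
- have Mdesc : td (th M) (gen (inr s)).
    rewrite -[th M](genK coxH (inr s)) (twisted_desc_genK coxH)
      -[(_ * th M)%g]theta_prod_cons.
    by rewrite twisted_desc_theta_prod ?uN.
  rewrite (RA_rec _ Mdesc) twisted_desc_theta_prod //
    -[(_ * th M)%g]theta_prod_cons both ?uN // IHL //.
  rewrite theta_prod_cons (genK coxH (inr s)) (twisted_R0 RAP) ?add0r.
    by rewrite -exprS -subSn ?size_subseq.
  (* The other term of the recursion vanishes: [theta_prod L] lies in the parabolic subgroup without
     [theta s], which is closed upwards and does not contain [theta s * theta_prod M]. *)
  pose P := [set~ inr s]%SET : {set 'I_n + 'I_n}.
  have thP (N : seq 'I_n) : s \notin N -> parabolic gen P (th N).
    move=> sN; apply: theta_prod_parabolic; apply/allP => i iN; rewrite !inE.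
    by apply: contra sN => /eqP[<-].
  have KP : K \subset P by apply/fintype.subsetP => -[i|i]; rewrite !inE.
  move=> /(twisted_le_parabolic_up coxH KP)/(_ (thP _ sL)).
  have MP : parabolic gen P (th M) by apply: thP; have /andP[] := uN _ sM.
  rewrite theta_prod_cons => /(parabolicMr coxH _ MP)/(gen_parabolic coxH (i := inr s)).
  by rewrite !inE eqxx.
- by rewrite ME both ?uN // IHL.
Qed.

Lemma card_compl_enum (I J : {set 'I_n}) : I \subset J ->
  (size (compl_enum I) - size (compl_enum J) = #|J| - #|I|)%N.
Proof.
by have := size_compl_enum I; have := size_compl_enum J; lia.
Qed.

Lemma Rtilde_one x : Rt x 1%g = (x == 1%g)%:R.
Proof.
have [->|x1] := eqVneq x 1%g; first exact: Rtilde1.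
by apply: (Rtilde0 RP) => /bruhat_le1 e; rewrite e eqxx in x1.
Qed.

Lemma phi_V_triple I a b (m : is_min_rep r I a) :
  f (V_triple hat b m) = (iota a * zz I * iota b^-1)%g.
Proof. by rewrite phiE. Qed.

Lemma twisted_R_base1 (I : {set 'I_n}) b1 a2 (J : {set 'I_n}) :
  is_min_rep r J a2 -> I \subset J -> parabolic r J b1 ->
  RA (zz I * iota b1^-1)%g (iota a2 * zz J)%g
  = ab ^+ (#|J| - #|I|) * Rt (a2 * b1)%g 1%g.
Proof.
move=> m2 IJ bJ; rewrite Rtilde_one; case: eqP => [ab1|ab1].
  have := min_rep_len coxW m2 bJ; rewrite ab1 cox_len1 => lab.
  have [a21 b11] : a2 = 1%g /\ b1 = 1%g by split; apply: (len_le1 coxW); lia.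
  rewrite a21 b11 invg1 (iota1 iota) mulg1 mul1g mulr1 -card_compl_enum //.
  by apply: twisted_R_theta_prod; [exact: compl_enum_uniq|exact: subseq_compl_enum].
rewrite mulr0; apply: (twisted_R0 RAP) => h; apply: ab1.
have m1 := @min_rep1 _ _ _ coxW I.
have := phi_V_triple b1 m1; have := phi_V_triple 1%g m2.
rewrite invg1 (iota1 iota) mulg1 mul1g => e2 e1.
rewrite -e1 -e2 in h; have [//|] := V_le_va1 (proj2 (phi_iso hat _ _) h).
by rewrite /va /vb /= => -> /bruhat_le1 ->; rewrite mulg1.
Qed.

Lemma left_desc_min_rep s a b (J : {set 'I_n}) : is_min_rep r J a ->
  is_min_rep r J (r s * a)%g -> parabolic r J b ->
  left_desc r s (a * b)%g = left_desc r s a.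
Proof.
move=> m m' bJ; rewrite /left_desc.
rewrite -!(cox_len_refl coxW); try exact: reflections_gen.
by rewrite mulgA !(min_rep_len coxW _ bJ) // ltn_add2r.
Qed.

(* [k] bounds [l_A(y) - l_A(x) + 1], where [x] and [y] are the arguments of [RA];
   for fixed [k] the induction is on the length of [a1]. *)
Lemma twisted_R_base k a1 (I : {set 'I_n}) b1 a2 (J : {set 'I_n}) :
  is_min_rep r I a1 -> is_min_rep r J a2 -> I \subset J -> parabolic r J b1 ->
  (lenW a1 + #|J| < k + lenW a2 + lenW b1 + #|I|)%N ->
  RA (iota a1 * zz I * iota b1^-1)%g (iota a2 * zz J)%g
  = ab ^+ (#|J| - #|I|) * Rt (a2 * b1)%g a1.
Proof.
have len_min (J' : {set 'I_n}) a :
  len (iota a * zz J')%g = (lenW a + size (compl_enum J'))%N.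
  by rewrite (len_theta_prod hat (iota_WK hat _) (compl_enum_uniq _)) (len_iota hat).
elim: k a1 b1 a2 => [|k IHk] a1 b1 a2 m1 m2 IJ bJ.
  (* For [k = 0] the bound reads [l_A(x) > l_A(y)], and it also gives [lenW a1 < lenW (a2 * b1)], so
     both sides vanish. *)
  move=> lt; have cIJ := subset_leq_card IJ.
  rewrite (Rtilde0 RP) ?mulr0; last first.
    by move=> /bruhat_leq_len; rewrite (min_rep_len coxW m2 bJ); lia.
  apply: (twisted_R0 RAP) => /(twisted_leq_len (K := K)).
  rewrite (twisted_lenE coxH (phi_min hat m1) (iota_WK hat _)).
  rewrite -[(iota a2 * _)%g]mulg1 (twisted_lenE coxH (phi_min hat m2) (parabolic1 gen K)).
  rewrite !len_min (len_iota hat) (cox_lenV coxW) cox_len1.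
  by have := size_compl_enum I; have := size_compl_enum J; lia.
have [m] := ubnP (lenW a1); elim: m a1 b1 a2 m1 m2 bJ => // m IHm a1 b1 a2 m1 m2 bJ.
rewrite ltnS => lm lt.
have [a11|/(left_desc_ex coxW)[s s1]] := eqVneq a1 1%g.
  by rewrite a11 (iota1 iota) mul1g twisted_R_base1.
have l1 : lenW a1 = (lenW (r s * a1)%g).+1.
  rewrite (cox_len_genl coxW) -/(left_desc r s a1) s1.
  by have := inv_parity_len_gt0 coxW s1; clear; lia.
have m1' := min_rep_desc coxW m1 s1.
set x := (iota a1 * zz I * _)%g; set y := (iota a2 * zz J)%g.
have sxE : (gen (inl s) * x)%g = (iota (r s * a1) * zz I * iota b1^-1)%g.
  by rewrite /x /= (iotaM iota) !mulgA.
have syE : (gen (inl s) * y)%g = (iota (r s * a2) * zz J)%g.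
  by rewrite /y /= (iotaM iota) !mulgA.
have tx : td x (gen (inl s)) = false.
  apply: (twisted_desc_min_rep coxH (phi_min hat m1) (iota_WK hat _)).
  by rewrite left_desc_theta_prod ?compl_enum_uniq.
have recD : td y (gen (inl s)) = false ->
    RA x y = RA (gen (inl s) * x)%g (gen (inl s) * y)%g.
  move=> ty; rewrite [RHS](RA_rec (i := inl s)) ?(twisted_desc_genK coxH) ?ty ?tx //.
  by rewrite !(genK coxH) addr0.
have lgt : (lenW (r s * a1)%g < m)%N by rewrite -ltnS -l1.
have ldm : left_desc gen (inl s) y = left_desc r s a2.
  by rewrite left_desc_theta_prod ?compl_enum_uniq.
(* If [s] is a descent of [a2] too, it is stripped from both sides with the gap unchanged. If
   [r s * a2] is longer and minimal, the recursion splits in the same way on both sides. *)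
have [s2|s2] := boolP (left_desc r s a2).
  have ty : td y (gen (inl s)) = false.
    rewrite -[y]mulg1; apply: (twisted_desc_min_rep coxH (phi_min hat m2)).
      exact: parabolic1.
    by rewrite ldm.
  have m2' := min_rep_desc coxW m2 s2.
  have l2 : lenW a2 = (lenW (r s * a2)%g).+1.
    rewrite (cox_len_genl coxW) -/(left_desc r s a2) s2.
    by have := inv_parity_len_gt0 coxW s2; clear; lia.
  rewrite recD // sxE syE IHm //; last by clear -lt l1 l2; lia.
  rewrite [in RHS](Rtilde_rec coxW RP _ s1) (left_desc_min_rep m2 m2' bJ) s2 addr0.
  by rewrite !mulgA.
have l2 : lenW (r s * a2)%g = (lenW a2).+1.
  by rewrite (cox_len_genl coxW) -/(left_desc r s a2) (negbTE s2).
have [m2'|[j jJ e]] := deodhar coxW s m2.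
  have s2' : left_desc r s (r s * a2)%g by rewrite (left_descN coxW).
  have ty : td y (gen (inl s)).
    rewrite -[y](genK coxH (inl s)) (twisted_desc_genK coxH) syE.
    rewrite -[(iota (r s * a2) * _)%g]mulg1
      (twisted_desc_min_rep coxH (phi_min hat m2')) //.
      exact: parabolic1.
    by rewrite left_desc_theta_prod ?compl_enum_uniq.
  rewrite (RA_rec _ ty) tx sxE syE IHk //; last by clear -lt l1 l2; lia.
  rewrite /x IHk //; last by clear -lt l1 l2; lia.
  have sab : (r s * a2 * b1 = r s * (a2 * b1))%g by rewrite mulgA.
  rewrite [in RHS](Rtilde_rec coxW RP _ s1) (left_desc_min_rep m2 m2' bJ) (negbTE s2).
  rewrite (Rtilde_rec coxW RP (r s * a2 * b1)%g s1) sab (left_descN coxW).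
  rewrite (left_desc_min_rep m2 m2' bJ) s2 addr0 (genK coxW).
  by ring.
(* In the case [r s * a2 = a2 * r j], [y] becomes [y * r_j], outside the shape treated here. The
   right-handed recursion moves [r_j] to [x], where [b1] becomes [r j * b1]; this mirrors
   [r s * (a2 * b1) = a2 * (r j * b1)] in the R-polynomial. *)
have jP := parabolic_gen r jJ.
have ybar : (gen (inl s) * y = y * gen (inl j))%g.
  by rewrite syE e (iotaM iota) -mulgA (compl_enum_comm hat jP) mulgA.
have jK : inl j \in K by rewrite inE.
have ly := twisted_len_genr coxH y jK.
have yl : l (y * gen (inl j))%g = l y + 1.
  have -> : (y * gen (inl j) = (iota a2 * zz J) * iota (r j))%g by [].
  rewrite (twisted_lenE coxH (phi_min hat m2) (iota_WK hat _)) (len_iota hat).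
  rewrite -[y]mulg1 (twisted_lenE coxH (phi_min hat m2) (parabolic1 gen K)).
  by rewrite cox_len1 (cox_len_gen coxW) sub0r addrC.
have ry : rd y (inl j) = false.
  move: ly; rewrite yl; case: (rd y (inl j)) => // /addrI.
  by clear; lia.
have ty : td y (gen (inl s)) = false by rewrite -(twisted_rdesc_twisted_desc K ybar).
rewrite recD // ybar (twisted_R_right coxH RAP jK _ ry).
have bJ' : parabolic r J (r j * b1)%g by exact: parabolicM.
have sxj : (gen (inl s) * x * gen (inl j) =
            iota (r s * a1) * zz I * iota (r j * b1)^-1)%g.
  rewrite sxE -mulgA; congr (_ * _)%g.
  by rewrite invgM (genV coxW) (iotaM iota).
have rx : rd (gen (inl s) * x)%g (inl j) = left_desc r j b1.
  rewrite -(twisted_rdescP coxH) sxj sxE.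
  rewrite !(twisted_lenE coxH (phi_min hat m1') (iota_WK hat _)) !(len_iota hat).
  rewrite !(cox_lenV coxW) ltrD2r ltz_nat (cox_len_refl coxW) //.
  exact: reflections_gen.
have sab : (r s * (a2 * b1) = a2 * (r j * b1))%g by rewrite !mulgA e.
have lab : left_desc r s (a2 * b1)%g = left_desc r j b1.
  rewrite /left_desc -!(cox_len_refl coxW); try exact: reflections_gen.
  by rewrite sab !(min_rep_len coxW m2) // ltn_add2l.
have lb := cox_len_genl coxW j b1; rewrite -/(left_desc r j b1) in lb.
rewrite rx sxj [in RHS](Rtilde_rec coxW RP _ s1) lab sab.
case: ifP lb => bj lb.
  rewrite !addr0 IHm //; have b0 := inv_parity_len_gt0 coxW bj.
  by rewrite lb; clear -lt l1 b0; lia.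
rewrite sxE IHk //; last by rewrite lb; clear -lt l1; lia.
rewrite IHk //; last by clear -lt l1; lia.
by ring.
Qed.

(** * Comparison of Springer's polynomials with the twisted R-polynomials *)

Section Springer.
Variable act : W * W -> Vset r -> Vset r.
Hypothesis actP : is_V_action act.
Variable btilde : Vset r -> Vset r -> laurent.
Hypothesis bP : is_springer_btilde act R btilde.

Lemma act_r_invol i v : act (1%g, r i) (act (1%g, r i) v) = v.
Proof.
case: actP => act1 actM _ _ _; rewrite -actM -[RHS]act1; congr act.
by congr pair; rewrite ?mulg1 ?(gen_sqr coxW).
Qed.

Lemma act_r_vb i v : vb (act (1%g, r i) v) = (r i * vb v)%g.
Proof. by case: actP => _ _ h _ _; rewrite /vb h. Qed.

Lemma act_r_dim i v : V_dim (act (1%g, r i) v) =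
  if left_desc r i (vb v) then V_dim v - 1 else V_dim v + 1.
Proof.
have [eI ea] : vI (act (1%g, r i) v) = vI v /\ va (act (1%g, r i) v) = va v.
  by case: actP => _ _ h _ _; rewrite /vI /va h.
rewrite /V_dim eI ea act_r_vb (cox_len_genl coxW) -/(left_desc r i (vb v)).
by case: ifP => [/(inv_parity_len_gt0 coxW)|_]; lia.
Qed.

Lemma T_act_r i m w : T_act act (1%g, r i) m w =
  m (act (1%g, r i) w) + (if left_desc r i (vb w) then alpha * m w else 0).
Proof.
set s := act (1%g, r i).
have sK v : s (s v) = v by exact: act_r_invol.
have sw : s w != w.
  apply/eqP => e; have := act_r_dim i w; rewrite -/s e.
  by case: ifP => _; lia.
rewrite /T_act (fsbigE [:: s w; w]).
- rewrite !big_cons big_nil !classical_sets.in_setT /= addr0 /T_basis /m_basis -/s sK.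
  have ds : (V_dim (s w) < V_dim w) = left_desc r i (vb w).
    by rewrite /s act_r_dim; case: ifP => _; clear; lia.
  rewrite ds !eqxx [w == s w]eq_sym (negbTE sw) !mulr0 if_same addr0 !mulr1 add0r.
  by case: ifP => _; rewrite ?mulr0 // mulrC.
- by rewrite /= inE sw.
- by [].
- move=> v _; rewrite !inE negb_or => /andP[v1 v2]; rewrite /T_basis /m_basis -/s.
  have -> : (w == s v) = false by apply/eqP => e; move: v1; rewrite e sK eqxx.
  by rewrite eq_sym (negbTE v2) !mulr0 if_same addr0 mulr0.
Qed.

(** This is the coefficient of [m_w] in Springer's (a) at [m_v0], where [v0] is one dimension below
    [v], so that [T_s m_v0 = m_v]. The [- alpha] of the inverse cancels [alpha] if [r i] is a
    descent of [vb w] and remains as [bar alpha] otherwise. *)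
Lemma btilde_rec i v w : left_desc r i (vb v) ->
  btilde w v = btilde (act (1%g, r i) w) (act (1%g, r i) v)
  + (if left_desc r i (vb w) then 0 else ab * btilde w (act (1%g, r i) v)).
Proof.
move=> vi; set v0 := act (1%g, r i) v.
case: bP => -[Delta [_ D1 D2]] _.
have fin : fin_support (m_basis v0).
  apply: (sub_finite_set _ (finite_set1 v0)) => u /=.
  by rewrite /m_basis; case: (eqVneq u v0) => // _; rewrite eqxx.
have sS : bold_S r (1%g, r i) by exists i; right.
have v0i : left_desc r i (vb v0) = false by rewrite act_r_vb (left_descN coxW) vi.
have Tv : T_act act (1%g, r i) (m_basis v0) = m_basis v.
  apply/funext => u; rewrite T_act_r /m_basis.
  have -> : (act (1%g, r i) u == v0) = (u == v).
    by apply/eqP/eqP => [/(congr1 (act (1%g, r i)))|->//]; rewrite !act_r_invol.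
  by case: (eqVneq u v0) => [->|_]; rewrite ?v0i ?mulr0 ?if_same addr0.
have := D2 _ _ sS fin; rewrite Tv !D1 => /(congr1 (@^~ w)) ->.
rewrite /T_inv_act T_act_r /alpha rmorphB /= rmorphV ?Lu_unit //= bar_Lu invrK.
by case: ifP => _; ring.
Qed.

Theorem btilde_twisted_R v w : btilde w v = RA (f w) (f v).
Proof.
have [k] := ubnP (lenW (vb v)); elim: k v w => // k IHk v w; rewrite ltnS => vk.
have [v1|/(left_desc_ex coxW)[i vi]] := eqVneq (vb v) 1%g.
  have [_ /(_ w v v1) [h0 h1]] := bP.
  have fv : f v = (iota (va v) * zz (vI v))%g by rewrite phiE v1 invg1 (iota1 iota) mulg1.
  have [[sub par]|nsub] := pselect (vI w \subset vI v /\ parabolic r (vI v) (vb w)).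
    (* The value of [k] only has to be large enough to make the bound automatic. *)
    rewrite h1 // fv phiE (@twisted_R_base (lenW (va w) + #|vI v|).+1) //;
      first exact: (va_min hat).
      exact: (va_min hat).
    by clear; lia.
  rewrite h0 // (twisted_R0 RAP) // => /(phi_iso hat) wv; apply: nsub.
  have [sI h] := V_le_sub wv; split=> //; apply: h => //.
  by rewrite v1; exact: parabolic1.
have jK : inl i \in K by rewrite inE.
have fr u : f (act (1%g, r i) u) = (f u * gen (inl i))%g.
  by rewrite (phi_act hat actP) (iota1 iota) mul1g -(iotaV iota) (genV coxW).
have rdE u : rd (f u) (inl i) = left_desc r i (vb u).
  rewrite -(twisted_rdescP coxH) -fr !(phi_len hat) act_r_dim.
  by case: ifP => _; lia.
set v0 := act (1%g, r i) v.
have vE : v = act (1%g, r i) v0 by rewrite act_r_invol.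
have v0i : left_desc r i (vb v0) = false by rewrite act_r_vb (left_descN coxW) vi.
have lt : (lenW (vb v0) < k)%N.
  rewrite (leq_trans _ vk) // act_r_vb (cox_len_refl coxW) //; exact: reflections_gen.
rewrite (btilde_rec _ vi) -/v0 !IHk // {vi vk}; clearbody v0; rewrite vE !fr.
by rewrite (twisted_R_right coxH RAP jK) ?rdE.
Qed.

End Springer.
End HatR.

Theorem theorem2p3 (n : nat) (W What : groupType) (r : 'I_n -> W)
    (iota : {multiplicative W -> What}) (theta : 'I_n -> What)
    (act : W * W -> Vset r -> Vset r) :
  is_hat_system r iota theta ->
  is_V_action act ->
  let gen := hat_gen r iota theta in
  let A := hat_A r iota theta in
  let Om := Omega iota theta in
  let f := @phi n W What r iota theta in
  [/\ forall x y z : What, Om x -> Om z ->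
        twisted_le gen A x y -> twisted_le gen A y z -> Om y,
      set_bij [set: Vset r] Om f /\
        (forall v w : Vset r, V_le v w <-> twisted_le gen A (f v) (f w)),
      forall v : Vset r, twisted_len gen A (f v) = V_dim v - n%:Z,
      forall (v : Vset r) (a b : W),
        f (act (a, b) v) = (iota a * f v * (iota b)^-1)%g &
      forall (R : W -> W -> {poly int}) (btilde : Vset r -> Vset r -> laurent)
          (RA : What -> What -> laurent),
        is_KL_R r R -> is_springer_btilde act R btilde ->
        is_twisted_R gen A RA ->
        forall v w : Vset r, btilde w v = RA (f w) (f v)].
Proof.
move=> hat actP /=; rewrite (hat_AE hat); split.
- by move=> x y z Ox _ xy _; exact: (Omega_up hat Ox xy).
- by split; [exact: phi_bij|exact: phi_iso].
- exact: phi_len.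
- by move=> v a b; exact: phi_act.
- by move=> R btilde RA RP bP RAP v w; exact: (btilde_twisted_R hat RP RAP actP bP).
Qed.
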